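(* Let $k$ be a field of characteristic $0$. Let $\Phi:\mathbf{Sh}\to\mathbf{QSh}$ be the linear map defined, for $n\ge0$ and $\sigma\in\mathfrak S_n$, by $$\Phi(\sigma)=\sum_{\tau\propto\sigma}\frac{\tau}{\tau!},$$ where the sum is over all $\tau\in\mathbb{S}\mathrm{urj}_n$ with $\tau\propto\sigma$. Then $\Phi$ is an injective Hopf algebra morphism. Moreover it is equivariant: for all $n$ and all $\sigma,\tau\in\mathfrak S_n$, $\Phi(\sigma\circ\tau)=\Phi(\sigma)\circ\tau$ (composition being extended linearly).
   Context: $\mathbb{S}\mathrm{urj}_n$ is the set of maps $\sigma:\{1,\dots,n\}\to\mathbb N^*$ with image $\{1,\dots,\max(\sigma)\}$, identified with packed words $\sigma(1)\cdots\sigma(n)$; $\mathfrak S_n\subset\mathbb{S}\mathrm{urj}_n$ is the set of permutations. For a word $u$ of positive integers, $Pack(u)$ is the unique packed word of the same length whose letters are in the same relative order (including equalities). $\tau\propto\sigma$ ($\sigma\in\mathfrak S_n$, $\tau\in\mathbb{S}\mathrm{urj}_n$) means: for all $1\le i,j\le n$, $\sigma(i)\le\sigma(j)\Rightarrow\tau(i)\le\tau(j)$. For $\tau\in\mathbb{S}\mathrm{urj}_n$, $\tau!=\prod_{i=1}^{\max(\tau)}|\tau^{-1}(\{i\})|!$. $\mathbf{QSh}$ is the vector space with basis $\bigsqcup_{n\ge0}\mathbb{S}\mathrm{urj}_n$, and $\mathbf{Sh}$ the vector space with basis $\bigsqcup_{n\ge0}\mathfrak S_n$. Hopf structure on $\mathbf{QSh}$: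 $\sigma\star\tau=\sum_{\zeta\in QSh_{\max\sigma,\max\tau}}\zeta\circ(\sigma\otimes\tau)$, where $QSh_{a,b}$ is the set of $\zeta\in\mathbb{S}\mathrm{urj}_{a+b}$ with $\zeta(1)<\dots<\zeta(a)$ and $\zeta(a+1)<\dots<\zeta(a+b)$, and $\sigma\otimes\tau$ is the word $\sigma$ followed by the word $\tau$ with all letters increased by $\max(\sigma)$; and $\Delta(\sigma)=\sum_{i=0}^{\max(\sigma)}\sigma_{|\{1,\dots,i\}}\otimes Pack(\sigma_{|\{i+1,\dots,\max(\sigma)\}})$, where $\sigma_{|I}$ is the subword of $\sigma$ consisting of the letters belonging to $I$. The Hopf structure on $\mathbf{Sh}$ is given by the same formulas for permutations, with $QSh_{a,b}$ replaced by $Sh_{a,b}=QSh_{a,b}\cap\mathfrak S_{a+b}$. The unit is the empty word. *)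

(* Defs.v *)
From HB Require Import structures.
From mathcomp Require Import all_boot ssralg finmap.
From mathcomp.multinomials Require Import monalg.

Set Implicit Arguments.
Unset Strict Implicit.
Unset Printing Implicit Defensive.

Import GRing.Theory.

(* A map sigma : {1..n} -> N^* is the word sigma(1)...sigma(n) : seq nat, so
   sigma(i) is [nth 0 sigma i.-1]; letters start at 1. *)

Definition word := seq nat.

Definition wmax (w : word) : nat := \max_(x <- w) x.

Definition packed (w : word) : bool :=
  (0 \notin w) && all (mem w) (iota 1 (wmax w)).

Definition isperm (w : word) : bool := perm_eq w (iota 1 (size w)).

(* Functional composition z o w, i |-> z(w(i)); meaningful when the letters of
   w are <= size z. *)
Definition wcomp (z w : word) : word := [seq nth 0 z x.-1 | x <- w].

Definition wtensor (s t : word) : word := s ++ [seq wmax s + x | x <- t].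

Definition restr (lo hi : nat) (w : word) : word := [seq x <- w | lo <= x <= hi].

(* Each letter x becomes its rank among the distinct letters of u; lemmas
   packed_pack, pack_le and pack_unique below show that this is the unique
   packed word in the same relative order. *)
Definition pack (u : word) : word :=
  [seq count (fun y => y <= x) (undup u) | x <- u].

Definition propto (t s : word) : bool :=
  (size t == size s) &&
  [forall i : 'I_(size s), forall j : 'I_(size s),
     (nth 0 s i <= nth 0 s j) ==> (nth 0 t i <= nth 0 t j)].

Definition wfact (t : word) : nat :=
  \prod_(1 <= i < (wmax t).+1) (count_mem i t)`!.

(* All words of length n with letters <= n and satisfying P. Packed words of
   length n have letters <= n, so [words packed n] enumerates Surj_n and
   [words isperm n] enumerates S_n (mem_words_packed, mem_words_isperm). *)
Definition words (P : pred word) (n : nat) : seq word :=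
  [seq w <- [seq map val (tval t) | t <- enum {: n.-tuple 'I_n.+1}] | P w].

(* The condition zeta(1)<...<zeta(a), zeta(a+1)<...<zeta(size zeta). *)
Definition increasing2 (a : nat) (z : word) : bool :=
  sorted ltn (take a z) && sorted ltn (drop a z).

Section WordFacts.
Implicit Types (u v w s t z : word) (n a b i x y : nat).

Lemma leq_wmax w x : x \in w -> x <= wmax w.
Proof. by move=> xw; rewrite /wmax; apply: leq_bigmax_seq. Qed.

Lemma wmax_leP w n : reflect (forall x, x \in w -> x <= n) (wmax w <= n).
Proof.
apply: (iffP idP) => [le x xw|h]; first exact: leq_trans (leq_wmax xw) le.
by rewrite /wmax; apply/bigmax_leqP_seq => x xw _; apply: h.
Qed.

Lemma mem_packed w x : packed w -> (x \in w) = (0 < x <= wmax w).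
Proof.
case/andP=> w0 /allP wall; apply/idP/idP => [xw|/andP[x_gt0 xm]].
  rewrite leq_wmax // andbT lt0n; apply: contraNneq w0 => <- //.
by apply: wall; rewrite mem_iota x_gt0 add1n ltnS.
Qed.

Lemma packedP w n : (forall x, (x \in w) = (0 < x <= n)) -> packed w && (wmax w == n).
Proof.
move=> h; have -> : wmax w = n.
  apply/eqP; rewrite eqn_leq; apply/andP; split.
    by apply/wmax_leP=> x; rewrite h => /andP[].
  by case: n h => // n h; apply: leq_wmax; rewrite h leqnn.
rewrite eqxx andbT; apply/andP; split; first by rewrite h.
apply/allP=> x; rewrite mem_iota add1n ltnS => xn.
have: wmax w <= n by apply/wmax_leP=> y; rewrite h => /andP[].
move=> le; rewrite /= h; case/andP: xn => -> /= xw; exact: leq_trans xw le.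
Qed.

Lemma packed_size w : packed w -> wmax w <= size w.
Proof.
move=> pw; rewrite -[wmax w](size_iota 1); apply: uniq_leq_size.
  exact: iota_uniq.
by move=> x; rewrite mem_iota add1n ltnS => h; rewrite mem_packed.
Qed.

Lemma mem_isperm w x : isperm w -> (x \in w) = (0 < x <= size w).
Proof. by move=> /perm_mem ->; rewrite mem_iota add1n ltnS. Qed.

Lemma isperm_uniq w : isperm w -> uniq w.
Proof. by move=> /perm_uniq ->; apply: iota_uniq. Qed.

Lemma isperm_packed w : isperm w -> packed w.
Proof. by move=> pw; case/andP: (packedP (fun x => mem_isperm x pw)). Qed.

Lemma isperm_wmax w : isperm w -> wmax w = size w.
Proof. by move=> pw; case/andP: (packedP (fun x => mem_isperm x pw)) => _ /eqP. Qed.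

Lemma ispermE w : isperm w = packed w && uniq w.
Proof.
apply/idP/andP => [pw|[pw uw]]; first by rewrite isperm_packed ?isperm_uniq.
have pe : perm_eq w (iota 1 (wmax w)).
  apply: uniq_perm => //; first exact: iota_uniq.
  by move=> x; rewrite mem_packed // mem_iota add1n ltnS.
by rewrite /isperm (perm_size pe) size_iota.
Qed.

Lemma mem_words P n w :
  (w \in words P n) = [&& P w, size w == n & all (fun x => x <= n) w].
Proof.
rewrite mem_filter; congr andb; apply/mapP/andP => [[t _ ->]|[/eqP <- /allP h]].
  rewrite size_map size_tuple eqxx; split=> //.
  by apply/allP=> _ /mapP[i _ ->]; rewrite -ltnS ltn_ord.
have szt : size (map (@inord (size w)) w) == size w by rewrite size_map.
exists (Tuple szt); first by rewrite mem_enum.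
rewrite /= -map_comp -[LHS]map_id; apply/eq_in_map => x xw /=.
by rewrite inordK // ltnS h.
Qed.

Lemma words_uniq P n : uniq (words P n).
Proof.
apply: filter_uniq; rewrite map_inj_uniq ?enum_uniq //.
by move=> s t h; apply: val_inj; apply: (inj_map val_inj).
Qed.

Lemma mem_words_packed n w : (w \in words packed n) = packed w && (size w == n).
Proof.
rewrite mem_words; case: (boolP (packed w)) => //= pw; rewrite andbC.
case: eqP => [<-|]; rewrite ?andbF ?andbT //.
by apply/allP=> x xw; apply: leq_trans (packed_size pw); apply: leq_wmax.
Qed.

Lemma mem_words_isperm n w : (w \in words isperm n) = isperm w && (size w == n).
Proof.
rewrite mem_words; case: (boolP (isperm w)) => //= pw.
have := mem_words_packed n w; rewrite mem_words (isperm_packed pw) /=.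
by move=> ->.
Qed.

Lemma mem_wcomp z w x : packed z -> packed w -> size z = wmax w ->
  (x \in wcomp z w) = (x \in z).
Proof.
move=> pz pw sz; apply/mapP/idP => [[y yw ->]|xz].
  apply: mem_nth; rewrite sz; move: yw; rewrite mem_packed //.
  by case: y => // y /andP[].
exists (index x z).+1; last by rewrite nth_index.
by rewrite mem_packed // -sz /= index_mem.
Qed.

Lemma packed_wcomp z w :
  packed z -> packed w -> size z = wmax w -> packed (wcomp z w).
Proof.
move=> pz pw sz; suff h : forall x, (x \in wcomp z w) = (0 < x <= wmax z) by case/andP: (packedP h).
by move=> x; rewrite mem_wcomp // mem_packed.
Qed.

Lemma isperm_wcomp z w :
  isperm z -> isperm w -> size z = wmax w -> isperm (wcomp z w).
Proof.
move=> pz pw sz; rewrite ispermE packed_wcomp ?isperm_packed //=.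
rewrite map_inj_in_uniq ?isperm_uniq // => x y.
rewrite !mem_packed ?isperm_packed // -sz.
case: x y => [|x] [|y] //= xz yz /eqP.
by rewrite nth_uniq ?isperm_uniq // => /eqP ->.
Qed.

Lemma mem_wtensor s t x : packed s -> packed t ->
  (x \in wtensor s t) = (0 < x <= wmax s + wmax t).
Proof.
move=> ps pt; rewrite mem_cat mem_packed //.
have -> : (x \in [seq wmax s + y | y <- t]) = (wmax s < x <= wmax s + wmax t).
  apply/mapP/andP => [[y yt ->]|[lt le]].
    by move: yt; rewrite mem_packed // -{1}[wmax s]addn0 ltn_add2l leq_add2l => /andP.
  exists (x - wmax s); last by rewrite subnKC // ltnW.
  by rewrite mem_packed // subn_gt0 lt leq_subLR.
case: (leqP x (wmax s)) => h; last by rewrite andbF /= (leq_ltn_trans _ h).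
by rewrite andbT /= orbF (leq_trans h (leq_addr _ _)) andbT.
Qed.

Lemma packed_wtensor s t : packed s -> packed t -> packed (wtensor s t).
Proof. by move=> ps pt; case/andP: (packedP (fun x => mem_wtensor x ps pt)). Qed.

Lemma wmax_wtensor s t : packed s -> packed t ->
  wmax (wtensor s t) = wmax s + wmax t.
Proof. by move=> ps pt; case/andP: (packedP (fun x => mem_wtensor x ps pt)) => _ /eqP. Qed.

Lemma isperm_wtensor s t : isperm s -> isperm t -> isperm (wtensor s t).
Proof.
move=> ps pt; rewrite ispermE packed_wtensor ?isperm_packed //=.
rewrite cat_uniq isperm_uniq //= map_inj_uniq; last exact: addnI.
rewrite isperm_uniq // andbT; apply/hasPn => _ /mapP[y yt ->] /=.
rewrite mem_packed ?isperm_packed // negb_and orbC -ltnNge.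
by rewrite -{1}[wmax s]addn0 ltn_add2l; move: yt; rewrite mem_isperm // => /andP[->].
Qed.

Lemma packed_restr w i : packed w -> i <= wmax w -> packed (restr 1 i w).
Proof.
move=> pw iw; suff h : forall x, (x \in restr 1 i w) = (0 < x <= i) by case/andP: (packedP h).
move=> x; rewrite mem_filter mem_packed //.
by case: (ltnP 0 x) => //= _; case: leqP => // /leq_trans -> .
Qed.

Lemma isperm_restr w i : isperm w -> i <= wmax w -> isperm (restr 1 i w).
Proof.
move=> pw iw.
by rewrite ispermE packed_restr ?isperm_packed //= filter_uniq ?isperm_uniq.
Qed.

Lemma size_pack u : size (pack u) = size u.
Proof. exact: size_map. Qed.

Let rank u x := count (fun y => y <= x) (undup u).

Let rank_leS u x y : x <= y -> rank u x <= rank u y.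
Proof. by move=> xy; apply: sub_count => z /= /leq_trans; apply. Qed.

Let rank_lt u x y : y \in u -> x < y -> rank u x < rank u y.
Proof.
move=> yu xy; rewrite /rank.
have yu' : y \in undup u by rewrite mem_undup.
rewrite !(permP (perm_to_rem yu')) /= leqnn [y <= x]leqNgt xy /= add0n add1n ltnS.
by apply: sub_count => z /= /leq_trans; apply; apply: ltnW.
Qed.

Let rank_le u x y : x \in u -> (rank u x <= rank u y) = (x <= y).
Proof.
move=> xu; case: (leqP x y) => [|yx]; first exact: rank_leS.
by apply/negbTE; rewrite -ltnNge rank_lt.
Qed.

Lemma pack_le u i j : i < size u -> j < size u ->
  (nth 0 (pack u) i <= nth 0 (pack u) j) = (nth 0 u i <= nth 0 u j).
Proof.
move=> iu ju; rewrite !(nth_map 0) //.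
by apply: rank_le; apply: mem_nth.
Qed.

Let rank_inj u : {in u &, injective (rank u)}.
Proof.
by move=> x y xu yu /eqP; rewrite eqn_leq !rank_le // -eqn_leq => /eqP.
Qed.

Lemma packed_pack u : packed (pack u).
Proof.
suff h : forall x, (x \in pack u) = (0 < x <= size (undup u)) by case/andP: (packedP h).
have sub : {subset map (rank u) (undup u) <= iota 1 (size (undup u))}.
  move=> _ /mapP[x xu ->]; rewrite mem_iota add1n ltnS count_size andbT.
  by rewrite -has_count; apply/hasP; exists x.
have un : uniq (map (rank u) (undup u)).
  rewrite map_inj_in_uniq ?undup_uniq // => x y; rewrite !mem_undup.
  exact: rank_inj.
have sz : size (iota 1 (size (undup u))) <= size (map (rank u) (undup u)).
  by rewrite size_iota size_map.
move=> x; have [_ eqi] := uniq_min_size un sub sz.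
have -> : (x \in pack u) = (x \in map (rank u) (undup u)).
  by apply: eq_mem_map => y; rewrite mem_undup.
by rewrite eqi mem_iota add1n ltnS.
Qed.

Lemma isperm_pack u : uniq u -> isperm (pack u).
Proof.
move=> uu; rewrite ispermE packed_pack map_inj_in_uniq //; exact: rank_inj.
Qed.

Lemma pack_id v : packed v -> pack v = v.
Proof.
move=> pv; rewrite -[RHS]map_id; apply/eq_in_map => x xv /=.
have pe : perm_eq (undup v) (iota 1 (wmax v)).
  apply: uniq_perm; rewrite ?undup_uniq ?iota_uniq // => y.
  by rewrite mem_undup mem_packed // mem_iota add1n ltnS.
rewrite (permP pe).
have xle : x <= wmax v := leq_wmax xv.
rewrite -(subnKC xle) iotaD count_cat.
have -> : count (fun y => y <= x) (iota 1 x) = x.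
  rewrite -[RHS](size_iota 1); apply/eqP; rewrite -all_count.
  by apply/allP=> y; rewrite mem_iota add1n ltnS => /andP[].
rewrite (_ : count _ _ = 0) ?addn0 //.
apply/eqP; rewrite -leqn0 leqNgt -has_count; apply/hasPn=> y.
by rewrite mem_iota add1n -ltnNge => /andP[].
Qed.

Lemma pack_unique u v : packed v -> size v = size u ->
  (forall i j, i < size u -> j < size u ->
     (nth 0 v i <= nth 0 v j) = (nth 0 u i <= nth 0 u j)) ->
  v = pack u.
Proof.
move=> pv sz ord; rewrite -[LHS](pack_id pv).
pose f x := nth 0 v (index x u).
have fle x y : x \in u -> y \in u -> (f x <= f y) = (x <= y).
  by move=> xu yu; rewrite ord ?index_mem // !nth_index.
have finj : {in u &, injective f}.
  by move=> x y xu yu /eqP; rewrite eqn_leq !fle // -eqn_leq => /eqP.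
have vE : v = map f u.
  apply: (@eq_from_nth _ 0); rewrite ?size_map // => i; rewrite sz => iu.
  rewrite (nth_map 0) //; apply/eqP; rewrite /f eqn_leq.
  have xu := mem_nth 0 iu.
  by rewrite !ord ?index_mem // !nth_index // leqnn.
have pe : perm_eq (undup v) (map f (undup u)).
  apply: uniq_perm; rewrite ?undup_uniq //.
    by rewrite map_inj_in_uniq ?undup_uniq // => x y; rewrite !mem_undup; apply: finj.
  by move=> y; rewrite mem_undup vE; apply: eq_mem_map => x; rewrite mem_undup.
rewrite /pack {2}vE -map_comp; apply/eq_in_map => x xu /=.
rewrite (permP pe) count_map; apply: eq_in_count => y; rewrite mem_undup => yu /=.
by rewrite fle.
Qed.

End WordFacts.

Local Open Scope ring_scope.

Section FreeModules.
Variable k : fieldType.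

(* Linear extension of a map given on the basis. *)
Definition linext (B : choiceType) (V : lmodType k) (f : B -> V)
    (x : {malg k[B]}) : V :=
  \sum_(b <- msupp x) x@_b *: f b.

Lemma linextU (B : choiceType) (V : lmodType k) (f : B -> V) b :
  linext f << b >> = f b.
Proof. by rewrite /linext msuppU oner_eq0 big_seq_fset1 mcoeffU eqxx scale1r. Qed.

(* The tensor product of the free modules on B and C is the free module on
   B * C, with u (x) v the basis vector << (u, v) >>. *)
Definition tens (B C : choiceType) (x : {malg k[B]}) (y : {malg k[C]}) :
    {malg k[(B * C)%type]} :=
  linext (fun b => linext (fun c => << (b, c) >>) y) x.

Definition tensmap (B C B' C' : choiceType)
    (f : {malg k[B]} -> {malg k[B']}) (g : {malg k[C]} -> {malg k[C']}) :
    {malg k[(B * C)%type]} -> {malg k[(B' * C')%type]} :=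
  linext (fun p : B * C => tens (f << p.1 >>) (g << p.2 >>)).

(* Structure maps of a bialgebra with basis B. *)
Record hopf_ops (B : choiceType) := HopfOps {
  mulb : B -> B -> {malg k[B]};
  oneb : {malg k[B]};
  comulb : B -> {malg k[(B * B)%type]};
  counitb : B -> k
}.

Section Ops.
Variables (B : choiceType) (H : hopf_ops B).

Definition hmul (x y : {malg k[B]}) : {malg k[B]} :=
  linext (fun b => linext (mulb H b) y) x.

Definition hmul_tens : {malg k[(B * B)%type]} -> {malg k[B]} :=
  linext (fun p : B * B => mulb H p.1 p.2).

Definition hcomul : {malg k[B]} -> {malg k[(B * B)%type]} := linext (comulb H).

Definition hcounit (x : {malg k[B]}) : k :=
  linext (counitb H : B -> k^o) x.

Definition is_antipode (S : {linear {malg k[B]} -> {malg k[B]}}) : Prop :=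
  forall x, hmul_tens (tensmap S idfun (hcomul x)) = hcounit x *: oneb H
         /\ hmul_tens (tensmap idfun S (hcomul x)) = hcounit x *: oneb H.

End Ops.

Record hopf_morphism (B C : choiceType) (H : hopf_ops B) (H' : hopf_ops C)
    (f : {malg k[B]} -> {malg k[C]}) : Prop := HopfMorphism {
  hm_linear : linear f;
  hm_mul : forall x y, f (hmul H x y) = hmul H' (f x) (f y);
  hm_one : f (oneb H) = oneb H';
  hm_comul : forall x, hcomul H' (f x) = tensmap f f (hcomul H x);
  hm_counit : forall x, hcounit H' (f x) = hcounit H x;
  (* Antipodes are unique when they exist. *)
  hm_antipode : forall S S', is_antipode H S -> is_antipode H' S' ->
    forall x, f (S x) = S' (f x)
}.

(* P is packed (for QSh) or isperm (for Sh). *)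
Definition basis (P : pred word) : choiceType := {w : word | P w}.

Section WordHopf.
Variable P : pred word.

(* The word w as a basis vector. The value 0 when w fails P is never reached
   below, by packed_wcomp, packed_wtensor, wmax_wtensor, packed_restr,
   packed_pack and their isperm analogues. *)
Definition vec (w : word) : {malg k[basis P]} :=
  if insub w is Some b then << b >> else 0.

Definition star (s t : word) : {malg k[basis P]} :=
  \sum_(z <- words P (wmax s + wmax t) | increasing2 (wmax s) z)
    vec (wcomp z (wtensor s t)).

Definition delta (s : word) : {malg k[(basis P * basis P)%type]} :=
  \sum_(0 <= i < (wmax s).+1)
    tens (vec (restr 1 i s)) (vec (pack (restr i.+1 (wmax s) s))).

Definition word_hopf : hopf_ops (basis P) := {|
  mulb := fun s t => star (val s) (val t);
  oneb := vec [::];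
  comulb := fun s => delta (val s);
  counitb := fun s => (val s == [::])%:R
|}.

End WordHopf.

Definition QSh : hopf_ops (basis packed) := word_hopf packed.
Definition Sh : hopf_ops (basis isperm) := word_hopf isperm.

Definition Phi : {malg k[basis isperm]} -> {malg k[basis packed]} :=
  linext (fun s : basis isperm =>
    \sum_(t <- words packed (size (val s)) | propto t (val s))
      ((wfact t)%:R)^-1 *: vec packed t).

(* x |-> x o t on QSh, used for x in the span of Surj_n and t in S_n. *)
Definition rcomp (t : word) : {malg k[basis packed]} -> {malg k[basis packed]} :=
  linext (fun r : basis packed => vec packed (wcomp (val r) t)).

End FreeModules.

(* Main.v *)
From HB Require Import structures.
Require Import Defs.
From mathcomp Require Import all_boot ssralg finmap.
From mathcomp.multinomials Require Import monalg.

(* A word t satisfies [propto t s] for a permutation s iff t = h o s, where h is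
   the sorted rearrangement of t. So Phi(s) is the sum of (h o s)/h! over the
   nondecreasing packed words h, i.e. the compositions of n; this gives
   equivariance at once, and compatibility with the coproducts is the
   deconcatenation of compositions.
   The product s * t in QSh is the sum of the packed words w whose first part
   packs to s and whose second part packs to t. Hence w has coefficient
   1/(u! v!) in Phi(s) * Phi(t), where u and v are its two parts, provided they
   are dominated by s and t. In Phi(s * t) its coefficient is N/w!, with N the
   number of ways of shuffling the sorted u and v into the sorted w; and
   N u! v! = w! by Pascal's rule.
   Phi is injective because s is the only permutation dominated by s. It
   commutes with antipodes because Phi o S and S' o Phi are both left inverses
   of Phi for convolution, and such an inverse is determined recursively. *)

Set Implicit Arguments.
Unset Strict Implicit.
Unset Printing Implicit Defensive.

Import GRing.Theory.

(** * Words *)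

Section Words.
Implicit Types (f h u v w s t z : word) (m : bitseq) (n a b i x y : nat).

Lemma size_wcomp z w : size (wcomp z w) = size w.
Proof. exact: size_map. Qed.

Lemma wcomp_cat z s t : wcomp z (s ++ t) = wcomp z s ++ wcomp z t.
Proof. exact: map_cat. Qed.

Lemma wcomp_iota f : wcomp f (iota 1 (size f)) = f.
Proof.
rewrite /wcomp (iotaDl 1 0) -map_comp -[RHS](mkseq_nth 0).
by apply: eq_map => i.
Qed.

(** The condition guards against default values: at a letter of [t] beyond [size s] the left side is
    0, while the right side reads the letter 0 of [s] and so returns the first letter of [f]. *)
Lemma wcompA f s t : {in t, forall x, 0 < x <= size s} ->
  wcomp (wcomp f s) t = wcomp f (wcomp s t).
Proof.
move=> ht; rewrite [RHS]/wcomp -map_comp; apply/eq_in_map => -[|x] /ht //= xs.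
by rewrite (nth_map 0).
Qed.

Lemma perm_wcomp f s : isperm s -> size f = size s -> perm_eq (wcomp f s) f.
Proof. by move=> ps sz; rewrite -{2}[f]wcomp_iota sz; apply: perm_map. Qed.

(** The letters of a packed [w] exhaust 1..[wmax w], so every letter of [f] is visible in
    [wcomp f w]. *)
Lemma wcomp_inj f g w : packed w -> size f = wmax w -> size g = wmax w ->
  wcomp f w = wcomp g w -> f = g.
Proof.
move=> pw szf szg /eq_in_map fg.
apply: (@eq_from_nth _ 0); first by rewrite szf szg.
by move=> i; rewrite szf => ile; apply: (fg i.+1); rewrite mem_packed.
Qed.

Lemma wcomp_isperm_inj f g s : isperm s -> size f = size s -> size g = size s ->
  (wcomp f s == wcomp g s) = (f == g).
Proof.
move=> ps szf szg; apply/eqP/eqP => [|-> //].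
by apply: wcomp_inj; rewrite ?isperm_packed ?isperm_wmax.
Qed.

Lemma wcomp_wtensor z s t : packed s -> packed t ->
  wcomp z (wtensor s t) = wcomp (take (wmax s) z) s ++ wcomp (drop (wmax s) z) t.
Proof.
move=> ps pt; rewrite wcomp_cat /wcomp -map_comp; congr (_ ++ _); apply/eq_in_map.
  by move=> x; rewrite mem_packed // => /andP[]; case: x => // x _ xs; rewrite nth_take.
move=> x; rewrite mem_packed // => /andP[]; case: x => // x _ xs /=.
by rewrite nth_drop addnS.
Qed.

Lemma packed_letter w x : packed w -> x \in w -> 0 < x <= wmax w.
Proof. by move=> /mem_packed <-. Qed.

Lemma isperm_letter w x : isperm w -> x \in w -> 0 < x <= size w.
Proof. by move=> /mem_isperm <-. Qed.

Lemma proptoP t s : reflect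
  (size t = size s /\ forall i j, i < size s -> j < size s ->
     nth 0 s i <= nth 0 s j -> nth 0 t i <= nth 0 t j)
  (propto t s).
Proof.
apply: (iffP andP) => [[/eqP sz /forallP h]|[sz h]]; split=> //; last 1 first.
- by apply/forallP=> i; apply/forallP=> j; apply/implyP; apply: h.
- by move=> i j li lj; move/forallP/(_ (Ordinal lj))/implyP: (h (Ordinal li)).
by rewrite sz.
Qed.

Lemma sorted_leqP w : reflect
  (forall i j, i <= j -> j < size w -> nth 0 w i <= nth 0 w j) (sorted leq w).
Proof.
apply: (iffP idP) => [sw i j ij jw|h].
  by apply: (sorted_leq_nth leq_trans leqnn) => //; rewrite inE // (leq_ltn_trans ij).
by apply/(sortedP 0) => i iw; apply: h.
Qed.

Lemma sorted_eq_sort f w : sorted leq f -> perm_eq f w -> f = sort leq w.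
Proof.
move=> sf pe; apply: (sorted_eq leq_trans anti_leq) => //.
  exact: sort_sorted leq_total _.
by rewrite perm_sym perm_sort perm_sym.
Qed.

Lemma propto_wcomp f s : isperm s -> size f = size s -> sorted leq f ->
  propto (wcomp f s) s.
Proof.
move=> ps sz /sorted_leqP sf; apply/proptoP; split; first exact: size_wcomp.
move=> i j li lj; rewrite !(nth_map 0) //.
have /andP[i0 _] := isperm_letter ps (mem_nth 0 li).
have /andP[j0 ju] := isperm_letter ps (mem_nth 0 lj).
by move=> le; apply: sf; rewrite ?sz ?prednK // -!subn1 leq_sub2r.
Qed.

(** Domination says that t o s^-1 is nondecreasing; being a rearrangement of [t], it must then be
    [sort leq t]. *)
Lemma propto_sort t s : isperm s ->
  propto t s = (t == wcomp (sort leq t) s).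
Proof.
move=> ps; apply/idP/eqP => [/proptoP[sz h]|E]; last first.
  have sz : size t = size s by rewrite E size_wcomp.
  by rewrite E propto_wcomp ?sort_sorted ?size_sort //; apply: leq_total.
(* [f] is t o s^-1: [index x s] is the position, counted from 0, at which [s] takes the value x. *)
pose f := [seq nth 0 t (index x s) | x <- iota 1 (size s)].
have szf : size f = size s by rewrite size_map size_iota.
have fE i : i < size s -> nth 0 f i = nth 0 t (index i.+1 s).
  by move=> li; rewrite (nth_map 0) ?size_iota // nth_iota.
have tE : t = wcomp f s.
  apply: (@eq_from_nth _ 0); first by rewrite size_wcomp.
  move=> i; rewrite sz => li; rewrite (nth_map 0) //.
  have /andP[x0 xs] := isperm_letter ps (mem_nth 0 li).
  by rewrite fE ?prednK // index_uniq // isperm_uniq.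
rewrite {1}tE; congr wcomp; apply: sorted_eq_sort; last first.
  by rewrite tE perm_sym perm_wcomp.
apply/sorted_leqP=> i j ij; rewrite szf => js; rewrite !fE ?(leq_ltn_trans ij) //.
have is_ : i.+1 \in s by rewrite mem_isperm //= (leq_ltn_trans ij).
have js_ : j.+1 \in s by rewrite mem_isperm.
by apply: h; rewrite ?index_mem // !nth_index.
Qed.

(** Sorting is inverse to h |-> h o s, by [propto_sort]. *)
Lemma words_propto s : isperm s ->
  perm_eq [seq t <- words packed (size s) | propto t s]
    [seq wcomp h s | h <- words packed (size s) & sorted leq h].
Proof.
move=> ps; apply: uniq_perm.
- by rewrite filter_uniq ?words_uniq.
- rewrite map_inj_in_uniq ?(filter_uniq _ (words_uniq _ _)) // => f g.
  rewrite [f \in _]mem_filter [g \in _]mem_filter !mem_words_packed.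
  move=> /and3P[_ _ /eqP szf] /and3P[_ _ /eqP szg].
  by apply: wcomp_inj; rewrite ?isperm_packed ?isperm_wmax.
move=> t; rewrite mem_filter mem_words_packed.
apply/and3P/mapP => [[pr pt /eqP sz]|[h]].
  move: (pr); rewrite propto_sort // => /eqP E; exists (sort leq t) => //.
  rewrite mem_filter sort_sorted; last exact: leq_total.
  rewrite mem_words_packed size_sort sz eqxx andbT /=.
  suff /packedP/andP[] : forall x, (x \in sort leq t) = (0 < x <= wmax t) by [].
  by move=> x; rewrite mem_sort mem_packed.
rewrite mem_filter mem_words_packed => /and3P[sh ph /eqP sz] ->.
split; [exact: propto_wcomp | | by rewrite size_wcomp].
by apply: packed_wcomp => //; rewrite ?isperm_packed ?isperm_wmax.
Qed.

(** Right composition with [t] is an injection of a finite set into itself, hence a bijection. *)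
Lemma words_wcomp n t : t \in words isperm n ->
  perm_eq [seq wcomp w t | w <- words packed n] (words packed n).
Proof.
rewrite mem_words_isperm => /andP[pt /eqP szt].
have un : uniq [seq wcomp w t | w <- words packed n].
  rewrite map_inj_in_uniq ?words_uniq // => f g; rewrite !mem_words_packed.
  move=> /andP[_ /eqP szf] /andP[_ /eqP szg].
  by apply: wcomp_inj; rewrite ?isperm_packed ?isperm_wmax // szt.
apply: uniq_perm; rewrite ?words_uniq //.
have sub : {subset [seq wcomp w t | w <- words packed n] <= words packed n}.
  move=> _ /mapP[w + ->]; rewrite !mem_words_packed => /andP[pw /eqP szw].
  rewrite size_wcomp szt eqxx packed_wcomp // ?isperm_packed //.
  by rewrite isperm_wmax // szw szt.
by apply: (uniq_min_size un sub _).2; rewrite size_map.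
Qed.

(** Composing with [t] leaves the sorted rearrangement of [w] unchanged, so both sides say that [w]
    is [sort leq w] composed with [s]. *)
Lemma propto_wcomp2 n w s t : isperm s -> isperm t ->
  size w = n -> size s = n -> size t = n ->
  propto (wcomp w t) (wcomp s t) = propto w s.
Proof.
move=> ps pt szw szs szt.
have pst : isperm (wcomp s t).
  by apply: isperm_wcomp => //; rewrite isperm_wmax // szs szt.
rewrite !propto_sort //.
have -> : sort leq (wcomp w t) = sort leq w.
  apply/esym/sorted_eq_sort; first exact: sort_sorted leq_total _.
  by rewrite perm_sort perm_sym perm_wcomp // szw szt.
rewrite -wcompA ?wcomp_isperm_inj ?size_wcomp ?szw ?szs //.
by move=> x /(isperm_letter pt); rewrite szt.
Qed.

(** The sorted rearrangement of a permutation is the identity. This is what makes [Phi]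
    injective. *)
Lemma propto_refl_isperm t s : isperm t -> isperm s -> propto t s -> t = s.
Proof.
move=> pt ps; rewrite propto_sort // => /eqP E.
have szt : size t = size s by rewrite E size_wcomp.
rewrite {}E.
have <- : iota 1 (size t) = sort leq t.
  by apply: sorted_eq_sort; rewrite ?iota_sorted // perm_sym.
rewrite /wcomp -[RHS]map_id; apply/eq_in_map => x xs.
have /andP[] := isperm_letter ps xs; case: x {xs} => // x _ xs.
by rewrite /= nth_iota ?szt.
Qed.

(* Extends [wfact] to words that need not be packed. *)
Fixpoint multfact w :=
  if w is x :: w' then (count_mem x w').+1 * multfact w' else 1.

(** Putting x in front of a word turns one factorial c! into (c+1)!, which is the factor in the
    recursion. Any bound [n] on the letters is allowed, so that two words can be compared over the
    same range. *)
Lemma multfactE n w : all (fun x => x < n) w ->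
  multfact w = \prod_(0 <= i < n) (count_mem i w)`!.
Proof.
elim: w => [|x w IH] /=; first by rewrite big1.
case/andP=> xn /IH ->; rewrite !big_mkord.
rewrite (bigD1 (Ordinal xn)) //= [in RHS](bigD1 (Ordinal xn)) //=.
rewrite mulnA eqxx add1n factS; congr (_ * _).
apply: eq_bigr => i; rewrite -val_eqE /= => /negbTE ix.
by rewrite eq_sym ix.
Qed.

Lemma all_ltn_wmax w : all (fun x => x < (wmax w).+1) w.
Proof. by apply/allP=> x /leq_wmax; rewrite ltnS. Qed.

Lemma perm_multfact u v : perm_eq u v -> multfact u = multfact v.
Proof.
move=> uv; have := all_ltn_wmax v; rewrite -(perm_all _ uv) => au.
rewrite (multfactE au) (multfactE (all_ltn_wmax v)).
by apply: eq_bigr => i _; rewrite (permP uv).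
Qed.

Lemma multfact_map (g : nat -> nat) w : {in w &, injective g} ->
  multfact (map g w) = multfact w.
Proof.
elim: w => //= x w IH inj; rewrite IH; last first.
  by move=> y z yw zw; apply: inj; rewrite inE (yw, zw) orbT.
congr (_.+1 * _); rewrite count_map; apply: eq_in_count => y yw /=.
apply/eqP/eqP => [|-> //]; apply: inj; rewrite !inE ?eqxx //.
by rewrite yw orbT.
Qed.

Lemma wfactE w : packed w -> wfact w = multfact w.
Proof.
(* [wfact] starts at the letter 1; the extra factor at 0 is 0! = 1, as 0 does not occur in [w]. *)
case/andP=> w0 _; rewrite (multfactE (all_ltn_wmax w)) big_nat_recl //.
by rewrite (count_memPn w0) fact0 mul1n /wfact big_add1.
Qed.

Lemma multfact_gt0 w : 0 < multfact w.
Proof. by elim: w => //= x w IH; rewrite muln_gt0. Qed.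

(** The relabelling that [pack u] applies to the letters of [u], named in order to use its
    injectivity. *)
Definition rank u x := count (fun y => y <= x) (undup u).

Lemma packE u : pack u = map (rank u) u.
Proof. by []. Qed.

Lemma rank_inj u : {in u &, injective (rank u)}.
Proof.
suff le x y : x \in u -> y \in u -> rank u x = rank u y -> x <= y.
  by move=> x y xu yu e; apply/eqP; rewrite eqn_leq !le.
(* [pack_le] compares positions, so the letters are looked up at their first occurrences. *)
move=> xu yu e; have := @pack_le u (index x u) (index y u).
rewrite !index_mem !(nth_map 0) ?index_mem // !nth_index //.
by rewrite -/(rank u x) -/(rank u y) e leqnn => <-.
Qed.

Lemma multfact_pack u : multfact (pack u) = multfact u.
Proof. by rewrite packE multfact_map //; apply: rank_inj. Qed.

Lemma wfact_pack u : wfact (pack u) = multfact u.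
Proof. by rewrite wfactE ?packed_pack // multfact_pack. Qed.

Lemma propto_pack u s : propto (pack u) s = propto u s.
Proof.
apply/proptoP/proptoP; rewrite size_pack => -[sz h]; split=> // i j li lj le.
  by rewrite -pack_le ?sz //; apply: h.
by rewrite pack_le ?sz //; apply: h.
Qed.

End Words.

(** * Shuffles *)

Section Shuffles.
Implicit Types (f h u v w s t z : word) (m : bitseq) (n a b i x y : nat).

(** A shuffle is encoded by the bits telling which factor each letter comes from. The recursion on
    the first bit is the one followed by [nshuffles_cons]. *)
Fixpoint bitseqs n : seq bitseq :=
  if n is n'.+1 then map (cons true) (bitseqs n') ++ map (cons false) (bitseqs n')
  else [:: [::]].

Lemma mem_cons_map (c d : bool) m (r : seq bitseq) :
  (c :: m \in map (cons d) r) = (c == d) && (m \in r).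
Proof.
apply/mapP/andP => [[m' mr [-> ->]]|[/eqP -> mr]]; first by rewrite eqxx.
by exists m.
Qed.

Lemma mem_bitseqs n m : (m \in bitseqs n) = (size m == n).
Proof.
elim: n m => [|n IH] [|c m] //=.
  by rewrite mem_cat; apply/norP; split; apply/mapP => -[].
by rewrite mem_cat !mem_cons_map IH eqSS; case: c; rewrite ?orbF.
Qed.

Lemma uniq_bitseqs n : uniq (bitseqs n).
Proof.
elim: n => //= n IH; rewrite cat_uniq !map_inj_uniq ?IH //; try by move=> ? ? [].
by rewrite andbT; apply/hasPn=> _ /mapP[m _ ->] /=; rewrite mem_cons_map.
Qed.

Definition comask m : bitseq := map negb m.

(** The coefficient of [h] in the classical shuffle product of the words [u] and [v]: sets of
    positions are counted, so repeated letters give multiplicities. *)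
Definition nshuffles h u v :=
  count (fun m => (mask m h == u) && (mask (comask m) h == v)) (bitseqs (size h)).

(** The first letter of a shuffle is the head of [u] or the head of [v]; the boolean factors say
    whether that head is x. *)
Lemma nshuffles_cons x h u v : nshuffles (x :: h) u v =
  (if u is y :: u' then (x == y) * nshuffles h u' v else 0) +
  (if v is y :: v' then (x == y) * nshuffles h u v' else 0).
Proof.
rewrite /nshuffles /= count_cat !count_map; congr (_ + _).
  case: u => [|y u]; first by rewrite -[RHS](@count_pred0 _ (bitseqs (size h))).
  have [->|xy] := eqVneq x y; last first.
    rewrite mul0n -[RHS](@count_pred0 _ (bitseqs (size h))).
    by apply: eq_count => m /=; rewrite eqseq_cons (negbTE xy).
  by rewrite mul1n; apply: eq_count => m /=; rewrite eqseq_cons eqxx.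
case: v => [|y v].
  rewrite -[RHS](@count_pred0 _ (bitseqs (size h))).
  by apply: eq_count => m /=; rewrite andbF.
have [->|xy] := eqVneq x y; last first.
  rewrite mul0n -[RHS](@count_pred0 _ (bitseqs (size h))).
  by apply: eq_count => m /=; rewrite eqseq_cons (negbTE xy) andbF.
by rewrite mul1n; apply: eq_count => m /=; rewrite eqseq_cons eqxx.
Qed.

Lemma sorted_min_head x u : sorted leq u -> all (leq x) u -> x \in u ->
  exists u', u = x :: u'.
Proof.
case: u => [|y u] //= pu /andP[xy _]; rewrite inE => /orP[/eqP <-|xu].
  by exists u.
exists u; congr (_ :: _); apply/eqP; rewrite eqn_leq xy andbT.
by have /allP := order_path_min leq_trans pu; apply.
Qed.

(* Pascal's rule: the minimal letter of h is the head of u or of v, and its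
   multiplicity in h is the sum of its multiplicities in u and v. *)
Lemma nshuffles_multfact h u v : sorted leq h -> sorted leq u -> sorted leq v ->
  perm_eq h (u ++ v) ->
  nshuffles h u v * (multfact u * multfact v) = multfact h.
Proof.
elim: h u v => [|x h IH] u v sh su sv pe.
  by move: (perm_size pe); rewrite size_cat; case: u v {su sv pe} => [|? ?] [].
have minx : all (leq x) (u ++ v).
  rewrite -(perm_all _ pe) /= leqnn.
  exact: order_path_min leq_trans sh.
have /andP[minu minv] : all (leq x) u && all (leq x) v by rewrite -all_cat.
have cnt : (count_mem x h).+1 = count_mem x u + count_mem x v.
  by rewrite -count_cat -(permP pe) /= eqxx.
have sh' : sorted leq h := path_sorted sh.
(* The multiplicity of x in the whole word splits into those in [u] and in [v]; each summand is
   matched with the shuffles that take x from that word. If x is absent from it, both sides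
   vanish. *)
rewrite nshuffles_cons /= cnt !mulnDl; congr (_ + _).
  have [xu|xu] := boolP (x \in u); last first.
    rewrite (count_memPn xu) mul0n; case: u xu {su pe minx minu cnt} => // y u.
    by rewrite inE negb_or => /andP[/negbTE -> _].
  have [u' uE] := sorted_min_head su minu xu; subst u; rewrite eqxx mul1n /=.
  rewrite eqxx add1n -(IH u' v) //; last by move: pe; rewrite /= perm_cons.
    by rewrite -!mulnA mulnCA.
  exact: path_sorted su.
have [xv|xv] := boolP (x \in v); last first.
  rewrite (count_memPn xv) mul0n; case: v xv {sv pe minx minv cnt} => // y v.
  by rewrite inE negb_or => /andP[/negbTE -> _].
have [v' vE] := sorted_min_head sv minv xv; subst v; rewrite eqxx mul1n /=.
rewrite eqxx add1n -(IH u v') //.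
- by rewrite [RHS]mulnCA; congr (_ * _); rewrite mulnCA.
- exact: path_sorted sv.
by rewrite -(perm_cons x) (permPl pe); apply: permEl (perm_catCA u [:: x] v').
Qed.

Lemma perm_mask_comask m h : size m = size h ->
  perm_eq (mask m h ++ mask (comask m) h) h.
Proof.
elim: h m => [|x h IH] [|[] m] //= [sz]; first by rewrite perm_cons IH.
by rewrite (perm_catCA (mask m h) [:: x]) /= perm_cons IH.
Qed.

Lemma size_comask m h : size m = size h ->
  size (mask (comask m) h) = size h - size (mask m h).
Proof.
by move=> /perm_mask_comask/perm_size <-; rewrite size_cat addKn.
Qed.

(* m marks the values taken on the first factor. *)
Definition shuffle_of n m : word :=
  mask m (iota 1 n) ++ mask (comask m) (iota 1 n).

(** Equal numbers of marks make the first parts equally long, hence equal; [m] is then read off from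
    membership in the first part. *)
Lemma shuffle_of_inj n m m' : size m = n -> size m' = n ->
  count id m = count id m' -> shuffle_of n m = shuffle_of n m' -> m = m'.
Proof.
move=> sz sz' cm /eqP; rewrite eqseq_cat ?size_mask ?size_iota // => /andP[/eqP e _].
apply: (@eq_from_nth _ false) => [|i]; first by rewrite sz sz'.
rewrite sz => ile.
have us : uniq (iota 1 n) by apply: iota_uniq.
have idx : index i.+1 (iota 1 n) = i.
  by rewrite -{1}[i.+1]add1n -(nth_iota 0 1 ile) index_uniq ?size_iota.
have mi : i.+1 \in iota 1 n by rewrite mem_iota.
by have := in_mask i.+1 m us; rewrite e in_mask // mi idx.
Qed.

(** Both parts of a shuffle are increasing, so it is determined by the set of its first [a] values,
    which [m] records. *)
Lemma words_shuffle a b :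
  perm_eq [seq z <- words isperm (a + b) | increasing2 a z]
    [seq shuffle_of (a + b) m | m <- bitseqs (a + b) & count id m == a].
Proof.
set n := a + b.
have st : ssrbool.transitive ltn by apply: ltn_trans.
have si : sorted ltn (iota 1 n) by apply: iota_ltn_sorted.
apply: uniq_perm.
- by rewrite filter_uniq ?words_uniq.
- rewrite map_inj_in_uniq ?(filter_uniq _ (uniq_bitseqs _)) // => m m'.
  rewrite !mem_filter !mem_bitseqs => /andP[/eqP cm /eqP sm] /andP[/eqP cm' /eqP sm'].
  by apply: shuffle_of_inj; rewrite ?cm.
move=> z; rewrite mem_filter mem_words_isperm; apply/and3P/mapP.
  move=> [/andP[s1 s2] pz /eqP sz].
  have szt : size (take a z) = a by rewrite size_takel // sz leq_addr.
  have uz := isperm_uniq pz.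
  pose P x := x \in take a z; exists (map P (iota 1 n)).
    rewrite mem_filter mem_bitseqs size_map size_iota eqxx andbT.
    rewrite count_map -[X in _ == X]szt; apply/eqP.
    rewrite -size_filter; apply: perm_size; apply: uniq_perm.
    - by rewrite filter_uniq ?iota_uniq.
    - exact: take_uniq.
    move=> x; rewrite mem_filter /= /P; case xz: (x \in take a z) => //=.
    by move: (mem_take xz); rewrite mem_isperm // sz mem_iota add1n ltnS.
  rewrite /shuffle_of /comask -map_comp -!filter_mask -[LHS](cat_take_drop a).
  congr (_ ++ _); apply: (irr_sorted_eq ltn_trans ltnn) => //.
  - exact: sorted_filter.
  - move=> x; rewrite mem_filter /= /P; case xz: (x \in take a z) => //=.
    by move: (mem_take xz); rewrite mem_isperm // sz mem_iota add1n ltnS.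
  - exact: sorted_filter.
  move=> x; rewrite mem_filter /= /P mem_iota add1n ltnS -sz -mem_isperm //.
  (* As [z] has no repetition, the values of its second part are exactly those missing from the
     first. *)
  move: uz; rewrite -{1 4}(cat_take_drop a z) cat_uniq mem_cat => /and3P[_ /hasPn dis _].
  by case xd: (x \in drop a z); [rewrite (dis _ xd) orbT|rewrite orbF andNb].
move=> [m]; rewrite mem_filter mem_bitseqs => /andP[/eqP cm /eqP sm] ->.
have szm : size (mask m (iota 1 n)) = a by rewrite size_mask ?size_iota.
have pe : perm_eq (shuffle_of n m) (iota 1 n).
  by apply: perm_mask_comask; rewrite size_iota.
have szs : size (shuffle_of n m) = n by rewrite (perm_size pe) size_iota.
split; last by rewrite szs.
  by rewrite /increasing2 take_size_cat // drop_size_cat // !sorted_mask.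
by rewrite /isperm szs.
Qed.

Lemma wcomp_mask m f n : size f = n -> wcomp f (mask m (iota 1 n)) = mask m f.
Proof. by move=> <-; rewrite /wcomp map_mask -/(wcomp _ _) wcomp_iota. Qed.

(** Composing [f] with [shuffle_of n m] lists the letters of [f] marked by [m], then the others; [s]
    and [t] rearrange these two subwords separately. *)
Lemma wcomp_shuffle f n m s t : size f = n -> size m = n ->
  isperm s -> isperm t -> count id m = size s -> n = size s + size t ->
  wcomp f (wcomp (shuffle_of n m) (wtensor s t)) =
  wcomp (mask m f) s ++ wcomp (mask (comask m) f) t.
Proof.
move=> szf szm ps pt cm nst.
have szm1 : size (mask m (iota 1 n)) = size s by rewrite size_mask ?size_iota.
have pe : perm_eq (shuffle_of n m) (iota 1 n).
  by apply: perm_mask_comask; rewrite size_iota.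
have pst := isperm_wtensor ps pt.
rewrite -wcompA; last first.
  move=> x; rewrite (perm_size pe) size_iota mem_wtensor ?isperm_packed //.
  by rewrite !isperm_wmax // nst.
rewrite wcomp_wtensor ?isperm_packed // isperm_wmax // {1 2}/shuffle_of.
by rewrite wcomp_cat take_size_cat ?drop_size_cat ?size_wcomp ?wcomp_mask.
Qed.

Lemma isperm_shuffle n m s t : size m = n ->
  isperm s -> isperm t -> n = size s + size t ->
  isperm (wcomp (shuffle_of n m) (wtensor s t)).
Proof.
move=> szm ps pt nst.
have pe : perm_eq (shuffle_of n m) (iota 1 n).
  by apply: perm_mask_comask; rewrite size_iota.
apply: isperm_wcomp.
- by rewrite /isperm (perm_size pe) size_iota.
- exact: isperm_wtensor.
by rewrite (perm_size pe) size_iota wmax_wtensor ?isperm_packed // !isperm_wmax.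
Qed.

Lemma size_wtensor s t : size (wtensor s t) = size s + size t.
Proof. by rewrite size_cat size_map. Qed.

(** With h the sorted [w], the shuffle given by [m] dominates [w] iff [m] cuts h into subwords whose
    composites with [s] and [t] are [u] and [v]. If [u] and [v] are dominated, these subwords are
    their sorted rearrangements, and [nshuffles_multfact] gives the count. *)
Lemma count_shuffle_propto w s t : isperm s -> isperm t ->
  size w = size s + size t ->
  let u := take (size s) w in let v := drop (size s) w in
  count (fun m => (count id m == size s) &&
     propto w (wcomp (shuffle_of (size w) m) (wtensor s t))) (bitseqs (size w))
    * (multfact u * multfact v) =
  (propto u s && propto v t) * multfact w.
Proof.
move=> ps pt szw u v; set n := size w.
have szu : size u = size s by rewrite size_takel // szw leq_addr.
have szv : size v = size t by rewrite size_drop szw addKn.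
have szh : size (sort leq w) = n by rewrite size_sort.
have main m : size m = n -> count id m == size s ->
    propto w (wcomp (shuffle_of n m) (wtensor s t)) =
    (u == wcomp (mask m (sort leq w)) s) &&
    (v == wcomp (mask (comask m) (sort leq w)) t).
  move=> szm /eqP cm; rewrite propto_sort; last exact: isperm_shuffle.
  rewrite wcomp_shuffle // -{1}[w](cat_take_drop (size s)) -/u -/v.
  by rewrite eqseq_cat // size_wcomp.
have sorted_m m : sorted leq (mask m (sort leq w)).
  by apply: sorted_mask; [exact: leq_trans | exact: sort_sorted leq_total _].
have szmask m : size m = n -> count id m == size s ->
    size (mask m (sort leq w)) = size s /\
    size (mask (comask m) (sort leq w)) = size t.
  move=> szm /eqP cm.
  have sz1 : size (mask m (sort leq w)) = size s by rewrite size_mask ?szh.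
  by split=> //; rewrite size_comask ?szh // sz1 /n szw addKn.
have [/andP[pu pv]|np] := boolP (propto u s && propto v t); last first.
  rewrite mul0n (_ : count _ _ = 0) ?mul0n //; apply/eqP.
  (* Subwords of a sorted word are sorted, so a single suitable [m] already forces [u] and [v] to be
     dominated. *)
  rewrite -leqn0 leqNgt -has_count; apply: contra np => /hasP[m].
  rewrite mem_bitseqs => /eqP szm /andP[cm]; rewrite main // => /andP[/eqP -> /eqP ->].
  have [sz1 sz2] := szmask _ szm cm.
  by rewrite !propto_wcomp.
rewrite mul1n -(perm_multfact (permEl (perm_sort leq w))).
rewrite -(perm_multfact (permEl (perm_sort leq u))).
rewrite -(perm_multfact (permEl (perm_sort leq v))).
have so z : sorted leq (sort leq z) by exact: sort_sorted leq_total _.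
rewrite -(@nshuffles_multfact (sort leq w) (sort leq u) (sort leq v)) //; last first.
  rewrite perm_sort -{1}[w](cat_take_drop (size s)) perm_sym.
  by apply: perm_cat; rewrite perm_sort.
congr (_ * _); rewrite /nshuffles szh; apply: eq_in_count => m.
rewrite mem_bitseqs => /eqP szm.
(* [nshuffles] has no condition on the number of marks: a wrong number cannot cut out a word of the
   length of [u]. *)
have [cm|ncm] := boolP (count id m == size s); last first.
  apply/esym/negbTE; rewrite negb_and; apply/orP; left.
  apply: contra ncm => /eqP/(congr1 size).
  by rewrite size_mask ?szh // size_sort szu => ->.
have [sz1 sz2] := szmask _ szm cm.
rewrite main //= !propto_sort // in pu pv *.
rewrite {1}(eqP pu) {1}(eqP pv) !wcomp_isperm_inj ?size_sort //.
by rewrite eq_sym [in X in _ && X]eq_sym.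
Qed.

End Shuffles.

(** * Quasi-shuffles and compositions *)

Section QuasiShuffles.
Implicit Types (f g h u v w s t z : word) (m : bitseq) (n a b i j x y : nat).

Lemma wmax_pack u : wmax (pack u) = size (undup u).
Proof.
have pu := packed_pack u; rewrite -(size_iota 1 (wmax _)) -(size_map (rank u) (undup u)).
apply: perm_size; rewrite perm_sym; apply: uniq_perm; rewrite ?iota_uniq //.
  rewrite map_inj_in_uniq ?undup_uniq // => x y; rewrite !mem_undup.
  exact: rank_inj.
move=> y; rewrite [RHS]mem_iota add1n ltnS -mem_packed // packE.
by apply: eq_mem_map => x; rewrite mem_undup.
Qed.

Lemma count_leq_sorted f x : sorted ltn f -> x \in f ->
  count (fun y => y <= x) f = (index x f).+1.
Proof.
elim: f => //= y f IH pf; rewrite inE eq_sym; case: eqVneq => [<-|yx] /=.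
  move=> _; rewrite leqnn (_ : count _ _ = 0) //; apply/eqP.
  rewrite -leqn0 leqNgt -has_count; apply/hasPn=> z zf /=; rewrite -ltnNge.
  by have /allP/(_ _ zf) := order_path_min ltn_trans pf.
move=> xf; rewrite IH ?(path_sorted pf) //.
by have /allP/(_ _ xf) := order_path_min ltn_trans pf; rewrite /= => /ltnW ->.
Qed.

(** Every word is a strictly increasing word composed with its packing: the letter of rank r is the
    r-th distinct letter in increasing order. *)
Lemma wcomp_sort_undup u : wcomp (sort leq (undup u)) (pack u) = u.
Proof.
set f := sort leq (undup u).
have sf : sorted ltn f.
  by rewrite ltn_sorted_uniq_leq sort_uniq undup_uniq sort_sorted //; apply: leq_total.
rewrite packE /wcomp -map_comp -[RHS]map_id; apply/eq_in_map => x xu /=.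
have xf : x \in f by rewrite mem_sort mem_undup.
have -> : rank u x = (index x f).+1.
  rewrite -count_leq_sorted //; apply/permP.
  by rewrite perm_sym perm_sort.
by rewrite /= nth_index.
Qed.

Lemma pack_wcomp f s : packed s -> size f = wmax s -> sorted ltn f ->
  pack (wcomp f s) = s.
Proof.
move=> ps sz sf; apply/esym/pack_unique; rewrite ?size_wcomp // => i j li lj.
rewrite !(nth_map 0) //.
have /andP[] := packed_letter ps (mem_nth 0 li).
have /andP[] := packed_letter ps (mem_nth 0 lj).
case: (nth 0 s i) (nth 0 s j) => [|x] [|y] //= _ ys _ xs.
have lt a b : b < wmax s -> a < b -> nth 0 f a < nth 0 f b.
  move=> bs ab; apply: (sorted_ltn_nth ltn_trans) => //; rewrite inE sz //.
  exact: ltn_trans bs.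
rewrite ltnS; case: (ltngtP x y) => [xy|yx|->]; last by rewrite leqnn.
  by rewrite ltnW ?lt.
by apply/esym/negbTE; rewrite -ltnNge lt.
Qed.

(* z is recovered from w by listing in increasing order the distinct letters of
   each of the two parts of w. *)
Lemma words_star s t : packed s -> packed t ->
  perm_eq
    [seq wcomp z (wtensor s t) |
       z <- words packed (wmax s + wmax t) & increasing2 (wmax s) z]
    [seq w <- words packed (size s + size t) |
       (pack (take (size s) w) == s) && (pack (drop (size s) w) == t)].
Proof.
move=> ps pt; have pst := packed_wtensor ps pt; have mst := wmax_wtensor ps pt.
apply: uniq_perm.
- rewrite map_inj_in_uniq ?(filter_uniq _ (words_uniq _ _)) // => f g.
  rewrite [f \in _]mem_filter [g \in _]mem_filter !mem_words_packed.
  by move=> /and3P[_ _ /eqP szf] /and3P[_ _ /eqP szg]; apply: wcomp_inj; rewrite ?mst.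
- by rewrite filter_uniq ?words_uniq.
move=> w; rewrite [RHS]mem_filter mem_words_packed; apply/mapP/and3P.
  move=> [z]; rewrite mem_filter mem_words_packed => /and3P[/andP[s1 s2] pz /eqP szz] ->.
  split; last by rewrite size_wcomp size_wtensor.
    rewrite wcomp_wtensor // take_size_cat ?drop_size_cat ?size_wcomp //.
    by rewrite !pack_wcomp ?eqxx // ?size_drop ?size_takel ?szz ?addKn ?leq_addr.
  by apply: packed_wcomp; rewrite ?mst.
move=> [/andP[/eqP e1 /eqP e2] pw /eqP szw].
set u := take (size s) w in e1; set v := drop (size s) w in e2.
have s1 : size (sort leq (undup u)) = wmax s by rewrite size_sort -wmax_pack e1.
have s2 : size (sort leq (undup v)) = wmax t by rewrite size_sort -wmax_pack e2.
pose z := sort leq (undup u) ++ sort leq (undup v); exists z.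
  rewrite mem_filter mem_words_packed size_cat s1 s2 eqxx andbT.
  rewrite /increasing2 take_size_cat // drop_size_cat // !ltn_sorted_uniq_leq.
  rewrite !sort_uniq !undup_uniq !sort_sorted /=; try exact: leq_total.
  (* [z] has the same letters as [w], hence is packed. *)
  suff /packedP/andP[] : forall x, (x \in z) = (0 < x <= wmax w) by [].
  move=> x; rewrite -mem_packed // mem_cat !mem_sort !mem_undup -mem_cat.
  by rewrite cat_take_drop.
rewrite wcomp_wtensor // take_size_cat // drop_size_cat // -e1 -e2.
by rewrite !wcomp_sort_undup cat_take_drop.
Qed.

(* The composition consists of the multiplicities of the letters of h. *)
Definition compositions n : seq word := [seq h <- words packed n | sorted leq h].

Lemma mem_compositions n h :
  (h \in compositions n) = [&& sorted leq h, packed h & size h == n].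
Proof. by rewrite mem_filter mem_words_packed. Qed.

Lemma uniq_compositions n : uniq (compositions n).
Proof. by rewrite filter_uniq ?words_uniq. Qed.

(** Grouped by the length [j] of the first word, to match the terms of the coproduct of a
    permutation. *)
Definition composition_pairs n : seq (word * word) :=
  [seq p | j <- iota 0 n.+1,
           p <- [seq (f, g) | f <- compositions j, g <- compositions (n - j)]].

Lemma mem_composition_pairs n f g : ((f, g) \in composition_pairs n) =
  [&& sorted leq f && packed f, sorted leq g && packed g & size f + size g == n].
Proof.
apply/allpairsPdep/and3P => [[j [_ [+ /allpairsP[[f' g'] /= [+ + ->]] [-> ->]]]]|].
  rewrite mem_iota add0n ltnS !mem_compositions => /andP[_ jn].
  move=> /and3P[-> -> /eqP ->] /and3P[-> -> /eqP ->].
  by split=> //; rewrite subnKC.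
move=> [/andP[sf pf] /andP[sg pg] /eqP <-]; exists (size f), (f, g).
rewrite mem_iota add0n ltnS leq_addr; split=> //.
apply/allpairsP; exists (f, g).
by rewrite !mem_compositions sf pf sg pg eqxx addKn eqxx.
Qed.

Lemma uniq_composition_pairs n : uniq (composition_pairs n).
Proof.
apply: allpairs_uniq_dep => [|j _|]; first exact: iota_uniq.
  by apply: allpairs_uniq; rewrite ?uniq_compositions // => -[? ?] [? ?].
move=> [j1 p1] [j2 p2] /allpairsPdep[i1 [q1 [_ h1 e1]]] /allpairsPdep[i2 [q2 [_ h2 e2]]] /= pp.
case: e1 h1 => <- <- /allpairsP[[f g] /= [+ _ e1]].
case: e2 h2 => <- <- /allpairsP[[f' g'] /= [+ _ e2]].
rewrite !mem_compositions => /and3P[_ _ /eqP <-] /and3P[_ _ /eqP <-].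
by rewrite pp e2 in e1 *; case: e1 => -> _.
Qed.

(** The first word is recovered from the product as the letters at most its maximum, which is why
    the maxima are assumed equal. *)
Lemma wtensor_inj f g f' g' :
  wmax f = wmax f' -> packed f -> packed f' -> packed g -> packed g' ->
  sorted leq f -> sorted leq f' ->
  wtensor f g = wtensor f' g' -> (f, g) = (f', g').
Proof.
move=> mf pf pf' pg pg' sf sf' e.
have restrE u v : packed u -> packed v -> restr 1 (wmax u) (wtensor u v) = u.
  move=> pu pv; rewrite /restr filter_cat -[RHS]cats0; congr (_ ++ _).
    by apply/all_filterP/allP=> x; rewrite mem_packed.
  apply/eqP; rewrite -size_eq0 size_filter -leqn0 leqNgt -has_count.
  apply/hasPn=> _ /mapP[x xv ->] /=; rewrite negb_and orbC -ltnNge.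
  by have /andP[x0 _] := packed_letter pv xv; rewrite -{1}[wmax u]addn0 ltn_add2l x0.
have ff : f = f' by rewrite -(restrE f g) // e mf restrE.
move: e; rewrite ff => /eqP; rewrite eqseq_cat // eqxx /= => /eqP e.
by rewrite (inj_map (@addnI _) e).
Qed.

End QuasiShuffles.

(** * Deconcatenation of compositions *)

Section Deconcatenation.
Implicit Types (f g h u v w s t z : word) (n a b i j x y : nat).

Lemma sorted_filter_cat h i : sorted leq h ->
  [seq x <- h | x <= i] ++ [seq x <- h | i < x] = h.
Proof.
elim: h => //= x h IH sh; have sh' := path_sorted sh.
have [xi|ix] := leqP x i; first by rewrite /= IH.
have /allP minx := order_path_min leq_trans sh.
rewrite (_ : filter _ h = [::]); last first.
  apply/eqP; rewrite -size_eq0 size_filter -leqn0 leqNgt -has_count.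
  by apply/hasPn=> y /minx xy; rewrite -ltnNge (leq_trans ix).
congr (_ :: _); apply/all_filterP/allP=> y /minx xy.
exact: leq_trans ix xy.
Qed.

Lemma restr_le i w : packed w -> restr 1 i w = [seq x <- w | x <= i].
Proof. by move=> pw; apply: eq_in_filter => x; rewrite mem_packed // => /andP[->]. Qed.

Lemma restr_gt i w : restr i.+1 (wmax w) w = [seq x <- w | i < x].
Proof. by apply: eq_in_filter => x /leq_wmax ->; rewrite andbT. Qed.

Lemma mem_restr_le i w x : packed w -> i <= wmax w ->
  (x \in restr 1 i w) = (0 < x <= i).
Proof.
move=> pw iw; rewrite mem_filter mem_packed //; case: (ltnP 0 x) => //= _.
by case: leqP => // /leq_trans ->.
Qed.

Lemma wmax_restr i w : packed w -> i <= wmax w -> wmax (restr 1 i w) = i.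
Proof.
by move=> pw iw; have /packedP/andP[_ /eqP] := fun x => @mem_restr_le i w x pw iw.
Qed.

Lemma mem_shift_restr i w x : packed w -> i <= wmax w ->
  (x \in [seq y - i | y <- restr i.+1 (wmax w) w]) = (0 < x <= wmax w - i).
Proof.
move=> pw iw; apply/mapP/andP => [[y + ->]|[x0 xle]].
  rewrite mem_filter => /andP[/andP[iy yw] _].
  by rewrite subn_gt0 iy leq_sub2r.
exists (i + x); last by rewrite addKn.
have xw : i + x <= wmax w by rewrite -leq_subRL.
rewrite mem_filter mem_packed // addn_gt0 x0 orbT xw !andbT.
by rewrite -{1}[i]addn0 ltn_add2l.
Qed.

(** The letters of [w] above [i] fill an interval starting at i+1, so packing only subtracts [i]. *)
Lemma pack_restr i w : packed w -> i <= wmax w ->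
  pack (restr i.+1 (wmax w) w) = [seq y - i | y <- restr i.+1 (wmax w) w].
Proof.
move=> pw iw; apply/esym/pack_unique; rewrite ?size_map //.
  by have /packedP/andP[] := fun x => @mem_shift_restr i w x pw iw.
move=> a b la lb; rewrite !(nth_map 0) //.
have := mem_nth 0 la; have := mem_nth 0 lb.
rewrite !mem_filter => /andP[/andP[bi _] _] /andP[/andP[ai _] _].
by rewrite leq_subLR subnKC // ltnW.
Qed.

(** Cutting a nondecreasing packed word after the letter i leaves a prefix and a suffix, the latter
    to be shifted down by i. Conversely, a pair is glued by [wtensor], and the cut is at the maximum
    of its first word. *)
Lemma words_deconcat n :
  perm_eq [seq (h, i) | h <- compositions n, i <- iota 0 (wmax h).+1]
    [seq (wtensor p.1 p.2, wmax p.1) | p <- composition_pairs n].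
Proof.
apply: uniq_perm.
- apply: allpairs_uniq_dep => [|h _|]; rewrite ?uniq_compositions ?iota_uniq //.
  by move=> [? ?] [? ?] _ _ /= [-> ->].
- rewrite map_inj_in_uniq ?uniq_composition_pairs // => -[f g] [f' g'].
  rewrite !mem_composition_pairs => /and3P[/andP[sf pf] /andP[_ pg] _].
  move=> /and3P[/andP[sf' pf'] /andP[_ pg'] _] [e m].
  apply: (wtensor_inj m) => //.
move=> [h i]; apply/allpairsPdep/mapP => [[h' [i' [+ + [-> ->]]]]|].
  rewrite mem_compositions mem_iota add0n ltnS => /and3P[sh ph /eqP sz] /andP[_ ih].
  set f := restr 1 i' h'; set g := [seq y - i' | y <- restr i'.+1 (wmax h') h'].
  have mf : wmax f = i' by apply: wmax_restr.
  have hE : wtensor f g = h'.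
    rewrite /wtensor mf -map_comp (_ : map _ _ = restr i'.+1 (wmax h') h').
      by rewrite /f restr_le // restr_gt sorted_filter_cat.
    rewrite -[RHS]map_id; apply/eq_in_map => y; rewrite mem_filter.
    by case/andP=> /andP[/ltnW iy _] _ /=; rewrite subnKC.
  exists (f, g); rewrite /= ?hE ?mf // mem_composition_pairs -size_wtensor hE sz eqxx.
  rewrite packed_restr // /g -pack_restr // packed_pack pack_restr // !andbT.
  apply/andP; split; first by apply: sorted_filter => //; apply: leq_trans.
  apply: homo_sorted (sorted_filter leq_trans _ sh) => y z; exact: leq_sub2r.
move=> [[f g]]; rewrite mem_composition_pairs => /and3P[/andP[sf pf] /andP[sg pg] sz].
move=> /= [-> ->]; exists (wtensor f g), (wmax f); split=> //; last first.
  by rewrite -[_ :: _]/(iota 0 _.+1) mem_iota add0n ltnS wmax_wtensor // leq_addr.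
rewrite mem_compositions packed_wtensor // size_wtensor sz !andbT.
apply/sorted_leqP => i' j ij; rewrite size_wtensor !nth_cat => jw.
have [jf|fj] := ltnP j (size f).
  by rewrite (leq_ltn_trans ij jf); move/sorted_leqP: sf; apply.
have jg : j - size f < size g by rewrite ltn_subLR.
have [if_|fi] := ltnP i' (size f).
  rewrite (nth_map 0) //; apply: leq_trans (leq_addr _ _).
  by apply/leq_wmax/mem_nth.
rewrite !(nth_map 0) // ?(leq_ltn_trans _ jg) ?leq_sub2r // leq_add2l.
by move/sorted_leqP: sg; apply=> //; apply: leq_sub2r.
Qed.

Lemma multfact_cat u v : ~~ has (mem u) v ->
  multfact (u ++ v) = multfact u * multfact v.
Proof.
elim: u => [|x u IH] /=; first by rewrite mul1n.
rewrite -all_predC => /allP uv.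
rewrite IH; last first.
  by rewrite -all_predC; apply/allP=> y /uv /=; rewrite inE negb_or => /andP[].
have xv : x \notin v by apply/negP=> /uv /=; rewrite inE eqxx.
by rewrite count_cat (count_memPn xv) addn0 mulnA.
Qed.

Lemma multfact_wtensor f g : packed f -> packed g ->
  multfact (wtensor f g) = multfact f * multfact g.
Proof.
move=> pf pg; rewrite multfact_cat.
  by congr (_ * _); apply: multfact_map => x y _ _; apply: addnI.
rewrite -all_predC; apply/allP=> _ /mapP[x xg ->] /=.
rewrite mem_packed // negb_and orbC -ltnNge -{1}[wmax f]addn0 ltn_add2l.
by have /andP[-> _] := packed_letter pg xg.
Qed.

(** The word h = f (x) g sends the letters up to [size f] to letters up to [wmax f] and all others
    above. So cutting h o s at the value [wmax f] amounts to cutting [s] at [size f]. *)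
Lemma restr_wcomp_wtensor f g s : packed f -> packed g -> isperm s ->
  size f + size g = size s ->
  restr 1 (wmax f) (wcomp (wtensor f g) s) = wcomp f (restr 1 (size f) s) /\
  pack (restr (wmax f).+1 (wmax (wtensor f g)) (wcomp (wtensor f g) s)) =
    wcomp g (pack (restr (size f).+1 (size s) s)).
Proof.
move=> pf pg ps sz; set h := wtensor f g.
have ph : packed h by apply: packed_wtensor.
have szh : size h = wmax s by rewrite size_wtensor sz isperm_wmax.
have ps' := isperm_packed ps.
have pw : packed (wcomp h s) by apply: packed_wcomp.
have mw : wmax (wcomp h s) = wmax h.
  apply/eqP; rewrite eqn_leq; apply/andP; split; apply/wmax_leP => x.
    by rewrite mem_wcomp //; apply: leq_wmax.
  by rewrite -(@mem_wcomp h s) //; apply: leq_wmax.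
have small x : 0 < x -> x <= size f -> nth 0 h x.-1 = nth 0 f x.-1.
  by case: x => // x _ xf; rewrite /h nth_cat xf.
have big x : x \in s -> size f < x ->
    nth 0 h x.-1 = wmax f + nth 0 g (x - size f).-1 /\ (x - size f).-1 < size g.
  move=> /(isperm_letter ps); case: x => // x /= xs; rewrite ltnS => fx.
  rewrite /h nth_cat ltnNge fx /= subSn //= (nth_map 0) // ltn_subLR // sz //.
(* The comparison is strict in the second part because the letters of [g] are positive. *)
have cmp x : x \in s -> (nth 0 h x.-1 <= wmax f) = (x <= size f).
  move=> xs; have /andP[x0 _] := isperm_letter ps xs.
  have [xf|fx] := leqP x (size f).
    by rewrite small // leq_wmax // mem_nth // prednK.
  have [-> gx] := big _ xs fx; rewrite -{2}[wmax f]addn0 leq_add2l leqn0.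
  by apply/negbTE; rewrite -lt0n; have /andP[] := packed_letter pg (mem_nth 0 gx).
split.
  rewrite !restr_le // /wcomp filter_map.
  rewrite (eq_in_filter (a2 := fun x => x <= size f)); last by move=> x /cmp.
  apply/eq_in_map=> x; rewrite mem_filter => /andP[xf xs].
  by rewrite small //; have /andP[] := isperm_letter ps xs.
rewrite -mw pack_restr ?mw ?wmax_wtensor ?leq_addr // -/h.
rewrite -{1}(isperm_wmax ps) pack_restr //; last first.
  by rewrite isperm_wmax // -sz leq_addr.
rewrite -wmax_wtensor // -/h -mw !restr_gt /wcomp filter_map -!map_comp.
rewrite (eq_in_filter (a2 := fun x => size f < x)); last first.
  by move=> x xs /=; rewrite ltnNge cmp // -ltnNge.
apply/eq_in_map=> x; rewrite mem_filter => /andP[fx xs] /=.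
have [-> _] := big _ xs fx; exact: addKn.
Qed.

Lemma size_restr_isperm i s : isperm s -> i <= size s ->
  size (restr 1 i s) = i /\ size (restr i.+1 (size s) s) = size s - i.
Proof.
move=> ps is_; have pp := isperm_packed ps; have m := isperm_wmax ps.
have sz1 : size (restr 1 i s) = i.
  by rewrite -isperm_wmax ?isperm_restr ?m ?wmax_restr ?m.
split=> //; move: sz1; rewrite restr_le // -{1}m restr_gt !size_filter => sz1.
rewrite -(count_predC (leq^~ i) s) sz1 addKn.
by apply: eq_count => x /=; rewrite ltnNge.
Qed.

End Deconcatenation.

Local Open Scope ring_scope.

(** * Linear extensions *)

Section LinearExtension.
Variables (k : fieldType).

Section One.
Variables (B : choiceType) (V : lmodType k).
Implicit Types (x y : {malg k[B]}) (f : B -> V).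

(** Lets sums over different supports be compared over a common larger set. *)
Lemma linextEw f x (d : {fset B}) :
  (msupp x `<=` d)%fset -> linext f x = \sum_(b <- d) x@_b *: f b.
Proof.
move=> xd; rewrite /linext (big_fset_incl _ xd) // => b _ /mcoeff_outdom ->.
by rewrite scale0r.
Qed.

Lemma linext_is_linear f : linear (linext f).
Proof.
move=> a x y; pose d := (msupp x `|` msupp y)%fset.
have xd : (msupp x `<=` d)%fset by apply: fsubsetUl.
have yd : (msupp y `<=` d)%fset by apply: fsubsetUr.
have axd := fsubset_trans (msuppZ_le a x) xd.
have sd : (msupp (a *: x + y) `<=` d)%fset.
  by apply: fsubset_trans (msuppD_le _ _) _; apply/fsubUsetP.
rewrite (linextEw _ sd) (linextEw _ xd) (linextEw _ yd) scaler_sumr -big_split.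
by apply: eq_bigr => b _ /=; rewrite mcoeffD mcoeffZ scalerDl scalerA.
Qed.

HB.instance Definition _ f :=
  GRing.isLinear.Build k {malg k[B]} V *:%R (linext f) (linext_is_linear f).

Lemma malg_sum x : x = \sum_(b <- msupp x) x@_b *: << b >>.
Proof.
rewrite {1}[x]monalgE; apply: eq_bigr => b _; apply/malgP=> c.
by rewrite mcoeffZ !mcoeffU mulr_natr.
Qed.

Lemma linear_ext (F G : {malg k[B]} -> V) :
  linear F -> linear G -> (forall b, F << b >> = G << b >>) -> F =1 G.
Proof.
move=> linF linG FG x.
pose F' := HB.pack_for {linear {malg k[B]} -> V} F
  (GRing.isLinear.Build _ _ _ _ _ linF).
pose G' := HB.pack_for {linear {malg k[B]} -> V} G
  (GRing.isLinear.Build _ _ _ _ _ linG).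
rewrite -[F]/(F' : _ -> _) -[G]/(G' : _ -> _) [x]malg_sum !linear_sum.
by apply: eq_bigr => b _; rewrite !linearZ /= FG.
Qed.

End One.

(** Common form of [tens] and [hmul], which are convertible to it, so that bilinearity is proved
    once. *)
Definition bilext (B C : choiceType) (V : lmodType k) (f : B -> C -> V)
  (x : {malg k[B]}) (y : {malg k[C]}) : V := linext (fun b => linext (f b) y) x.

Section Two.
Variables (B C : choiceType) (V : lmodType k) (f : B -> C -> V).

Lemma bilextU b c : bilext f << b >> << c >> = f b c.
Proof. by rewrite /bilext !linextU. Qed.

Lemma bilext_linearl y : linear (fun x => bilext f x y).
Proof. by move=> a x x'; rewrite /bilext linearP. Qed.

Lemma bilext_linearr x : linear (bilext f x).
Proof.
move=> a y y'; rewrite /bilext /linext scaler_sumr -big_split.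
by apply: eq_bigr => b _ /=; rewrite -!/(linext _ _) linearP scalerDr !scalerA mulrC.
Qed.

HB.instance Definition _ x :=
  GRing.isLinear.Build k {malg k[C]} V *:%R (bilext f x) (bilext_linearr x).

Lemma bilext_sumZl (I : Type) (r : seq I) (Q : pred I) (a : I -> k) F y :
  bilext f (\sum_(i <- r | Q i) a i *: F i) y =
  \sum_(i <- r | Q i) a i *: bilext f (F i) y.
Proof. by rewrite /bilext linear_sum; apply: eq_bigr => i _; rewrite linearZ. Qed.

Lemma bilext_sumZr (I : Type) (r : seq I) (Q : pred I) (a : I -> k) F x :
  bilext f x (\sum_(i <- r | Q i) a i *: F i) =
  \sum_(i <- r | Q i) a i *: bilext f x (F i).
Proof. by rewrite linear_sum; apply: eq_bigr => i _; rewrite linearZ. Qed.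

End Two.

Lemma bilext_ext (B C : choiceType) (V : lmodType k)
    (F G : {malg k[B]} -> {malg k[C]} -> V) :
  (forall y, linear (F^~ y)) -> (forall x, linear (F x)) ->
  (forall y, linear (G^~ y)) -> (forall x, linear (G x)) ->
  (forall b c, F << b >> << c >> = G << b >> << c >>) -> F =2 G.
Proof.
move=> Fl Fr Gl Gr FG x y.
apply: (linear_ext (Fl y) (Gl y)) => b.
exact: (linear_ext (Fr _) (Gr _)).
Qed.

Lemma tensE (B C : choiceType) (x : {malg k[B]}) (y : {malg k[C]}) :
  tens x y = bilext (fun b c => << (b, c) >>) x y.
Proof. by []. Qed.

Lemma hmulE (B : choiceType) (H : hopf_ops k B) (x y : {malg k[B]}) :
  hmul H x y = bilext (mulb H) x y.
Proof. by []. Qed.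

Lemma tensU (B C : choiceType) (b : B) (c : C) :
  tens << b >> << c >> = << (b, c) >> :> {malg k[(B * C)%type]}.
Proof. exact: bilextU. Qed.

(** The universal property of the tensor product: a bilinear map factors through [tens]. *)
Lemma linext_tens (B C : choiceType) (V : lmodType k) (f : B -> C -> V) x y :
  linext (fun p => f p.1 p.2) (tens x y) = bilext f x y.
Proof.
move: x y; apply: bilext_ext => [y|x|y|x|b c] => [a u v|a u v|||].
- by rewrite tensE bilext_linearl linearP.
- by rewrite tensE bilext_linearr linearP.
- exact: bilext_linearl.
- exact: bilext_linearr.
- by rewrite tensU linextU bilextU.
Qed.

Lemma tensmap_linear (B C B' C' : choiceType)
    (f : {malg k[B]} -> {malg k[B']}) (g : {malg k[C]} -> {malg k[C']}) :
  linear (tensmap f g).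
Proof. exact: linext_is_linear. Qed.

HB.instance Definition _ (B C B' C' : choiceType)
    (f : {malg k[B]} -> {malg k[B']}) (g : {malg k[C]} -> {malg k[C']}) :=
  GRing.isLinear.Build k {malg k[(B * C)%type]} {malg k[(B' * C')%type]} *:%R
    (tensmap f g) (tensmap_linear f g).

Lemma tensmap_tens (B C B' C' : choiceType)
    (f : {linear {malg k[B]} -> {malg k[B']}})
    (g : {linear {malg k[C]} -> {malg k[C']}}) x y :
  tensmap f g (tens x y) = tens (f x) (g y).
Proof.
rewrite /tensmap (linext_tens (fun b c => tens (f << b >>) (g << c >>))).
move: x y; apply: bilext_ext => [y|x|y|x|b c] => [||a u v|a u v|].
- exact: bilext_linearl.
- exact: bilext_linearr.
- by rewrite linearP tensE bilext_linearl.
- by rewrite linearP tensE bilext_linearr.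
- by rewrite bilextU.
Qed.

Lemma tensmap_comp (B C B1 C1 B2 C2 : choiceType)
    (f : {malg k[B]} -> {malg k[B1]}) (g : {malg k[C]} -> {malg k[C1]})
    (f' : {linear {malg k[B1]} -> {malg k[B2]}})
    (g' : {linear {malg k[C1]} -> {malg k[C2]}}) x :
  tensmap f' g' (tensmap f g x) = tensmap (f' \o f) (g' \o g) x.
Proof.
apply: (linear_ext (F := tensmap f' g' \o tensmap f g)) x => [||p].
- exact: linearP.
- exact: linearP.
by rewrite /= /tensmap !linextU -/(tensmap _ _ _) tensmap_tens.
Qed.

Lemma hmul_morphism (B C : choiceType) (H : hopf_ops k B) (H' : hopf_ops k C)
    (f : {linear {malg k[B]} -> {malg k[C]}}) :
  (forall b c, f (mulb H b c) = hmul H' (f << b >>) (f << c >>)) ->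
  forall x y, f (hmul H x y) = hmul H' (f x) (f y).
Proof.
move=> fM; apply: bilext_ext => [y|x|y|x|b c] => [a u v|a u v|a u v|a u v|].
- by rewrite hmulE bilext_linearl linearP.
- by rewrite hmulE bilext_linearr linearP.
- by rewrite linearP hmulE bilext_linearl.
- by rewrite linearP hmulE bilext_linearr.
- by rewrite hmulE bilextU fM.
Qed.

Lemma hmul_tens_linear (B : choiceType) (H : hopf_ops k B) :
  linear (hmul_tens H).
Proof. exact: linext_is_linear. Qed.

HB.instance Definition _ (B : choiceType) (H : hopf_ops k B) :=
  GRing.isLinear.Build k {malg k[(B * B)%type]} {malg k[B]} *:%R
    (hmul_tens H) (hmul_tens_linear H).

Lemma hmul_tensE (B : choiceType) (H : hopf_ops k B) x y :
  hmul_tens H (tens x y) = hmul H x y.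
Proof. exact: linext_tens. Qed.

Lemma hmul_tens_morphism (B C : choiceType) (H : hopf_ops k B)
    (H' : hopf_ops k C) (f : {linear {malg k[B]} -> {malg k[C]}}) :
  (forall x y, f (hmul H x y) = hmul H' (f x) (f y)) ->
  forall z, f (hmul_tens H z) = hmul_tens H' (tensmap f f z).
Proof.
move=> fM; apply: (linear_ext (F := f \o hmul_tens H)
  (G := hmul_tens H' \o tensmap f f)) => [||[b c]].
- exact: linearP.
- exact: linearP.
by rewrite /= -tensU tensmap_tens !hmul_tensE fM.
Qed.

End LinearExtension.

Lemma big_pick (V : nmodType) (I : eqType) (r : seq I) (P : pred I) (F : I -> V) x :
  uniq r -> x \in r ->
  \sum_(y <- r | P y && (x == y)) F y = if P x then F x else 0.
Proof.
move=> ur xr; rewrite big_mkcond (bigD1_seq x) //= eqxx andbT big1 ?addr0 // => y.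
by rewrite eq_sym => /negbTE ->; rewrite andbF.
Qed.

Lemma eq_big_mem (V : nmodType) (I : eqType) (r : seq I) (P Q : pred I) (F G : I -> V) :
  {in r, P =1 Q} -> (forall i, i \in r -> P i -> F i = G i) ->
  \sum_(i <- r | P i) F i = \sum_(i <- r | Q i) G i.
Proof.
move=> PQ FG; rewrite big_seq_cond [RHS]big_seq_cond; apply: eq_big => [i|i /andP[]].
  by case ir: (i \in r); rewrite //= PQ.
exact: FG.
Qed.

Lemma packed_nil : packed [::].
Proof. exact: (@isperm_packed [::]). Qed.

(** * The map Phi *)

Section WordModules.
Variable k : fieldType.

Section WordBasis.
Variable P : pred word.

Lemma vec_val (b : basis P) : vec k P (val b) = << b >>.
Proof. by rewrite /vec valK. Qed.

Lemma vec_linear_ext (V : lmodType k) (F G : {linear {malg k[basis P]} -> V}) :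
  (forall w, P w -> F (vec k P w) = G (vec k P w)) -> F =1 G.
Proof.
move=> FG; apply: linear_ext => [||b]; try exact: linearP.
by rewrite -vec_val FG ?(valP b).
Qed.

Lemma linext_vec (V : lmodType k) (F : word -> V) w : P w ->
  linext (fun b : basis P => F (val b)) (vec k P w) = F w.
Proof. by move=> Pw; rewrite -[w]/(val (Sub w Pw : basis P)) vec_val linextU. Qed.

Lemma mcoeff_vec w (c : basis P) : P w -> (vec k P w)@_c = (w == val c)%:R.
Proof.
by move=> Pw; rewrite -[w]/(val (Sub w Pw : basis P)) vec_val mcoeffU (inj_eq val_inj).
Qed.

Lemma hmul_vec s t : P s -> P t ->
  hmul (word_hopf k P) (vec k P s) (vec k P t) = star k P s t.
Proof.
move=> Ps Pt.
by rewrite -[s]/(val (Sub s Ps : basis P)) -[t]/(val (Sub t Pt : basis P))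
  !vec_val hmulE bilextU.
Qed.

Lemma hcomul_vec s : P s -> hcomul (word_hopf k P) (vec k P s) = delta k P s.
Proof. exact: (linext_vec (delta k P)). Qed.

Lemma hcounit_vec s : P s -> hcounit (word_hopf k P) (vec k P s) = (s == [::])%:R.
Proof. exact: (@linext_vec k^o (fun w => (w == [::])%:R)). Qed.

Lemma hcomul_linear : linear (hcomul (word_hopf k P)).
Proof. exact: linext_is_linear. Qed.

HB.instance Definition _ := GRing.isLinear.Build k {malg k[basis P]}
  {malg k[(basis P * basis P)%type]} *:%R (hcomul (word_hopf k P)) hcomul_linear.

Lemma hcounit_linear : linear (hcounit (word_hopf k P) : _ -> k^o).
Proof. exact: linext_is_linear. Qed.

HB.instance Definition _ := GRing.isLinear.Build k {malg k[basis P]}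
  k^o *:%R (hcounit (word_hopf k P) : _ -> k^o) hcounit_linear.

End WordBasis.

Lemma star_packed s t : packed s -> packed t ->
  star k packed s t = \sum_(w <- words packed (size s + size t) |
    (pack (take (size s) w) == s) && (pack (drop (size s) w) == t)) vec k packed w.
Proof.
move=> ps pt; rewrite -[RHS]big_filter -(perm_big _ (words_star ps pt)) big_map.
by rewrite big_filter.
Qed.

Lemma star_isperm s t : isperm s -> isperm t ->
  star k isperm s t =
  \sum_(m <- bitseqs (size s + size t) | count id m == size s)
    vec k isperm (wcomp (shuffle_of (size s + size t) m) (wtensor s t)).
Proof.
move=> ps pt; rewrite /star !isperm_wmax // -[LHS]big_filter.
by rewrite (perm_big _ (words_shuffle _ _)) big_map big_filter.
Qed.

(** In the product of s with the empty word, the second part of w is empty and w packs to s; being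
    packed, w is s. *)
Lemma hmul_vec_nil x : hmul (QSh k) x (vec k packed [::]) = x.
Proof.
move: x; apply: (linear_ext (bilext_linearl _ _)) => [a u v //|b].
rewrite -vec_val -[LHS]/(hmul (word_hopf k packed) _ _) hmul_vec ?(valP b) ?packed_nil //.
rewrite star_packed ?(valP b) ?packed_nil //=.
set s := val b; have ps : packed s := valP b.
have sw : s \in words packed (size s) by rewrite mem_words_packed ps eqxx.
transitivity (\sum_(w <- words packed (size s) | true && (s == w)) vec k packed w).
  rewrite addn0; apply: eq_big_mem => // w; rewrite mem_words_packed.
  move=> /andP[pw /eqP szw].
  by rewrite take_oversize ?drop_oversize ?szw // pack_id // andbT eq_sym.
by rewrite (big_pick xpredT) ?words_uniq.
Qed.

Lemma Phi_linear : linear (@Phi k).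
Proof. exact: linext_is_linear. Qed.

HB.instance Definition _ := GRing.isLinear.Build k {malg k[basis isperm]}
  {malg k[basis packed]} *:%R (@Phi k) Phi_linear.

Lemma Phi_vec s : isperm s -> Phi (vec k isperm s) =
  \sum_(t <- words packed (size s) | propto t s) ((wfact t)%:R)^-1 *: vec k packed t.
Proof.
exact: (linext_vec (fun s => \sum_(t <- words packed (size s) | propto t s)
  ((wfact t)%:R)^-1 *: vec k packed t)).
Qed.

(** The coefficient is that of [h] because h o s is a rearrangement of [h]. *)
Lemma Phi_vec_comp s : isperm s -> Phi (vec k isperm s) =
  \sum_(h <- compositions (size s)) ((multfact h)%:R)^-1 *: vec k packed (wcomp h s).
Proof.
move=> ps; rewrite (Phi_vec ps) -[LHS]big_filter (perm_big _ (words_propto ps)) big_map.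
rewrite -/(compositions (size s)); apply: eq_big_seq => h.
rewrite mem_compositions => /and3P[_ ph /eqP szh].
rewrite wfactE; last by apply: packed_wcomp; rewrite // ?isperm_packed // isperm_wmax.
by rewrite (perm_multfact (perm_wcomp ps szh)).
Qed.

Lemma Phi_one : Phi (vec k isperm [::]) = vec k packed [::].
Proof.
rewrite Phi_vec_comp //= (perm_big [:: [::]]) ?big_seq1 /= ?invr1 ?scale1r //.
apply: uniq_perm => //; first exact: uniq_compositions.
move=> h; rewrite mem_compositions inE; case: h => [|x h]; first by rewrite packed_nil.
by rewrite /= !andbF.
Qed.

Lemma rcomp_linear t : linear (@rcomp k t).
Proof. exact: linext_is_linear. Qed.

HB.instance Definition _ t := GRing.isLinear.Build k {malg k[basis packed]}
  {malg k[basis packed]} *:%R (@rcomp k t) (rcomp_linear t).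

Lemma rcomp_vec t w : packed w -> rcomp t (vec k packed w) = vec k packed (wcomp w t).
Proof. exact: (linext_vec (fun w => vec k packed (wcomp w t))). Qed.

(** The bijection w |-> w o t carries the words dominated by [s] to those dominated by s o t and
    keeps multiplicities. *)
Lemma Phi_equivariant n s t : s \in words isperm n -> t \in words isperm n ->
  Phi (vec k isperm (wcomp s t)) = rcomp t (Phi (vec k isperm s)).
Proof.
move=> sn tn; move: (sn) (tn); rewrite !mem_words_isperm.
move=> /andP[ps /eqP szs] /andP[pt /eqP szt].
have pst : isperm (wcomp s t).
  by apply: isperm_wcomp => //; rewrite isperm_wmax // szs szt.
rewrite (Phi_vec ps) (Phi_vec pst) linear_sum size_wcomp szs szt.
rewrite -(perm_big _ (words_wcomp tn)) big_map /=; apply: eq_big_mem => w.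
  by rewrite mem_words_packed => /andP[pw /eqP szw]; apply: (propto_wcomp2 ps pt szw).
rewrite mem_words_packed => /andP[pw /eqP szw] _.
have szwt : size w = size t by rewrite szw szt.
have pwt : packed (wcomp w t).
  by apply: packed_wcomp; rewrite // ?isperm_packed // isperm_wmax.
rewrite linearZ /= (rcomp_vec _ pw) (wfactE pw) (wfactE pwt).
by rewrite (perm_multfact (perm_wcomp pt szwt)).
Qed.

Lemma Phi_counit x : hcounit (QSh k) (Phi x) = hcounit (Sh k) x.
Proof.
move: x; apply: (@vec_linear_ext _ k^o
  (hcounit (QSh k) \o @Phi k) (hcounit (Sh k))) => s ps /=.
rewrite hcounit_vec //; case: s ps => [|x s] ps; first by rewrite Phi_one hcounit_vec ?packed_nil.
(* All terms of the image have the length of the permutation, here nonzero, so the counit kills each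
   of them. *)
rewrite (Phi_vec_comp ps) (linear_sum (hcounit (QSh k) : _ -> k^o)) big_seq big1 // => h.
rewrite mem_compositions => /and3P[_ ph /eqP szh].
have pw : packed (wcomp h (x :: s)).
  by apply: packed_wcomp; rewrite // ?isperm_packed // isperm_wmax.
by rewrite linearZ /= (hcounit_vec pw) /= mulr0n scaler0.
Qed.

End WordModules.

(** * Products, coproducts, injectivity and convolution *)

Section HopfMorphism.
Variable k : fieldType.

(** Each [w] comes from exactly one pair of terms, the packings of its two parts, and packing
    changes neither domination nor multiplicities. *)
Lemma star_Phi s t : isperm s -> isperm t ->
  hmul (QSh k) (Phi (vec k isperm s)) (Phi (vec k isperm t)) =
  \sum_(w <- words packed (size s + size t) |
      propto (take (size s) w) s && propto (drop (size s) w) t)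
    ((multfact (take (size s) w) * multfact (drop (size s) w))%:R)^-1
      *: vec k packed w.
Proof.
move=> ps pt; rewrite (Phi_vec _ ps) (Phi_vec _ pt) hmulE bilext_sumZl.
pose c (w : word) : k := ((wfact w)%:R)^-1.
(* With the conditions inside the summand, the range of [w] is independent of s' and t', and the
   sums can be exchanged. *)
pose F s' t' w := if (pack (take (size s) w) == s') && (pack (drop (size s) w) == t')
  then c s' *: (c t' *: vec k packed w) else 0.
transitivity (\sum_(s' <- words packed (size s) | propto s' s)
    \sum_(t' <- words packed (size t) | propto t' t)
    \sum_(w <- words packed (size s + size t)) F s' t' w).
  apply: eq_big_mem => // s'; rewrite mem_words_packed => /andP[ps' /eqP szs'] _.
  rewrite bilext_sumZr scaler_sumr.
  apply: eq_big_mem => // t'; rewrite mem_words_packed => /andP[pt' /eqP szt'] _.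
  rewrite -hmulE hmul_vec // star_packed // szs' szt' scalerA scaler_sumr big_mkcond.
    by apply: eq_bigr => w _; rewrite /F scalerA.
under eq_bigr => s' _ do rewrite exchange_big /=.
rewrite exchange_big /= [RHS]big_mkcond; apply: eq_big_seq => w.
rewrite mem_words_packed => /andP[pw /eqP szw].
set u := take (size s) w; set v := drop (size s) w.
have szu : size u = size s by rewrite size_takel // szw leq_addr.
have szv : size v = size t by rewrite size_drop szw addKn.
have pick (r : word) (n : nat) (G : word -> {malg k[basis packed]}) x : size r = n ->
    \sum_(y <- words packed n | propto y x) (if pack r == y then G y else 0) =
    if propto r x then G (pack r) else 0.
  move=> szr; rewrite -big_mkcondr big_pick ?words_uniq ?propto_pack //.
  by rewrite mem_words_packed packed_pack size_pack szr eqxx.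
transitivity (\sum_(s' <- words packed (size s) | propto s' s)
  if pack u == s' then
    if propto v t then c s' *: (c (pack v) *: vec k packed w) else 0 else 0).
  apply: eq_bigr => s' _.
  rewrite -(pick v (size t) (fun t' => c s' *: (c t' *: vec k packed w)) t szv).
  have [e|ne] := eqVneq (pack u) s'.
    by apply: eq_bigr => t' _; rewrite /F -/u -/v e eqxx.
  by rewrite big1 // => t' _; rewrite /F -/u -/v (negbTE ne).
rewrite (pick u _ (fun s' => if propto v t then
  c s' *: (c (pack v) *: vec k packed w) else 0)) //.
case: (propto u s); last by [].
case: (propto v t); last by [].
by rewrite /= scalerA /c !wfact_pack natrM invfM.
Qed.

(** The coefficients of each [w] are compared: [count_shuffle_propto] equates them after
    multiplication by factorials, which are invertible in characteristic 0. *)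
Lemma Phi_star (hchar : [pchar k] =i pred0) s t : isperm s -> isperm t ->
  Phi (star k isperm s t) =
  hmul (QSh k) (Phi (vec k isperm s)) (Phi (vec k isperm t)).
Proof.
move=> ps pt; rewrite star_Phi // star_isperm // linear_sum.
set n := (size s + size t)%N.
have n0 (m : nat) : (0 < m)%N -> m%:R != 0 :> k.
  by rewrite lt0n; move/pcharf0P: hchar => ->.
pose G m w : {malg k[basis packed]} :=
  if propto w (wcomp (shuffle_of n m) (wtensor s t))
  then ((wfact w)%:R)^-1 *: vec k packed w else 0.
transitivity (\sum_(m <- bitseqs n | count id m == size s)
    \sum_(w <- words packed n) G m w).
  apply: eq_big_mem => // m; rewrite mem_bitseqs => /eqP szm _.
  rewrite /= Phi_vec; last exact: isperm_shuffle.
  by rewrite size_wcomp size_wtensor big_mkcond.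
rewrite exchange_big /= [RHS]big_mkcond; apply: eq_big_seq => w.
rewrite mem_words_packed => /andP[pw /eqP szw].
(* The summand no longer depends on the shuffle, so the sum is the number of suitable shuffles times
   one vector. *)
rewrite -big_mkcondr big_const_seq iter_addr_0 -scaler_nat scalerA.
have := count_shuffle_propto ps pt szw; rewrite /= szw -/n.
set N := count _ _; rewrite wfactE //.
set u := take _ _; set v := drop _ _ => /(congr1 (fun x => x%:R : k)).
rewrite natrM [(_ * multfact w)%:R]natrM => e.
have nu : (multfact u * multfact v)%:R != 0 :> k.
  by apply: n0; rewrite muln_gt0 !multfact_gt0.
have nw : (multfact w)%:R != 0 :> k by rewrite n0 ?multfact_gt0.
have -> : N%:R / (multfact w)%:R =
    (propto u s && propto v t)%:R / (multfact u * multfact v)%:R :> k.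
  by apply/eqP; rewrite eqr_div // e mulrC.
by case: ifP => _; rewrite ?mul1r // mul0r scale0r.
Qed.

(** Both sides become sums over pairs of compositions: on the left by cutting a composition, on the
    right by applying [Phi] to both factors of a cut of [s]. *)
Lemma Phi_delta s : isperm s ->
  hcomul (QSh k) (Phi (vec k isperm s)) = tensmap (@Phi k) (@Phi k) (delta k isperm s).
Proof.
move=> ps; have pp := isperm_packed ps; have ms := isperm_wmax ps.
pose G (h : word) (i : nat) : {malg k[(basis packed * basis packed)%type]} :=
  ((multfact h)%:R)^-1 *: tens (vec k packed (restr 1 i (wcomp h s)))
    (vec k packed (pack (restr i.+1 (wmax h) (wcomp h s)))).
transitivity (\sum_(h <- compositions (size s)) \sum_(i <- iota 0 (wmax h).+1) G h i).
  rewrite (Phi_vec_comp _ ps) linear_sum; apply: eq_big_seq => h.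
  rewrite mem_compositions => /and3P[_ ph /eqP szh].
  have pw : packed (wcomp h s) by apply: packed_wcomp; rewrite // ms.
  rewrite linearZ /= hcomul_vec // /delta.
  have -> : wmax (wcomp h s) = wmax h.
    by rewrite /wmax (perm_big _ (perm_wcomp ps szh)).
  by rewrite scaler_sumr /index_iota subn0.
rewrite -(big_allpairs_dep (I2 := fun=> nat) (F := fun p => G p.1 p.2)
  (h := fun (h : word) (i : nat) => (h, i))).
rewrite (perm_big _ (words_deconcat _)) big_map /= big_allpairs_dep.
rewrite /delta linear_sum ms /index_iota subn0.
(* Here [j] is at once the length of the first composition and the place where [s] is cut. *)
apply: eq_big_seq => j; rewrite mem_iota add0n ltnS => /andP[_ js] /=.
have [sz1 sz2] := size_restr_isperm ps js.
have p1 : isperm (restr 1 j s) by rewrite isperm_restr ?ms.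
have p2 : isperm (pack (restr j.+1 (size s) s)).
  by apply: isperm_pack; rewrite filter_uniq // isperm_uniq.
rewrite tensmap_tens /= (Phi_vec_comp _ p1) (Phi_vec_comp _ p2) size_pack sz1 sz2 big_allpairs_dep.
rewrite tensE bilext_sumZl; apply: eq_big_seq => f.
rewrite mem_compositions => /and3P[_ pf /eqP szf].
rewrite bilext_sumZr scaler_sumr; apply: eq_big_seq => g.
rewrite mem_compositions => /and3P[_ pg /eqP szg] /=.
have sz : (size f + size g = size s)%N by rewrite szf szg subnKC.
have [e1 e2] := restr_wcomp_wtensor pf pg ps sz.
rewrite /G e1 e2 szf (multfact_wtensor pf pg) natrM invfM -scalerA -tensE.
reflexivity.
Qed.

Lemma multfact_uniq w : uniq w -> multfact w = 1%N.
Proof.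
by elim: w => //= x w IH /andP[xw uw]; rewrite IH // (count_memPn xw).
Qed.

Definition packed_of_perm (s : basis isperm) : basis packed :=
  Sub (val s) (isperm_packed (valP s)).

(** Among permutations, each one dominates only itself, with coefficient 1/1! = 1. Thus [x] is read
    off from [Phi x]. *)
Lemma mcoeff_Phi (x : {malg k[basis isperm]}) s : (Phi x)@_(packed_of_perm s) = x@_s.
Proof.
rewrite [x in LHS](malg_sum x) [x in RHS](malg_sum x) linear_sum !raddf_sum.
apply: eq_bigr => b _; rewrite /= linearZ /= !mcoeffZ; congr (_ * _).
rewrite -vec_val mcoeff_vec ?(valP b) // Phi_vec ?(valP b) // raddf_sum.
have ps : isperm (val s) := valP s; have pb : isperm (val b) := valP b.
transitivity (\sum_(t <- words packed (size (val b)) |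
    propto t (val b) && (val s == t)) 1 : k).
  rewrite [RHS]big_mkcondr; apply: eq_big_mem => // t; rewrite mem_words_packed => /andP[pt _] _ /=.
  rewrite mcoeffZ mcoeff_vec // eq_sym; case: eqP => [<-|]; rewrite ?mulr0 //.
  by rewrite wfactE ?isperm_packed // multfact_uniq ?isperm_uniq // invr1 mulr1.
(* If the lengths differ, [s] is not in the range of summation and both sides are 0. *)
have [szb|nsz] := eqVneq (size (val s)) (size (val b)); last first.
  rewrite big_seq_cond big1 => [|t /andP[]]; last first.
    by rewrite mem_words_packed => /andP[_ szt] /andP[_ /eqP e]; rewrite -e (negbTE nsz) in szt.
  rewrite (_ : (val b == val s) = false) //; apply/eqP => e.
  by rewrite e eqxx in nsz.
rewrite big_pick ?words_uniq //; last by rewrite mem_words_packed isperm_packed // szb eqxx.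
have [pr|npr] := boolP (propto _ _).
  by rewrite (propto_refl_isperm ps pb pr) eqxx.
case: eqVneq => // e; case/negP: npr; rewrite -e.
by apply/proptoP.
Qed.

Lemma Phi_inj : injective (@Phi k).
Proof. by move=> x y e; apply/malgP => s; rewrite -!mcoeff_Phi e. Qed.

(* In the convolution of F and Phi at s, the term of s (x) 1 is F s, and the
   others involve F only at shorter words. *)
Lemma convolution_cancel (F G : {linear {malg k[basis isperm]} -> {malg k[basis packed]}}) :
  (forall x, hmul_tens (QSh k) (tensmap F (@Phi k) (hcomul (Sh k) x)) =
             hmul_tens (QSh k) (tensmap G (@Phi k) (hcomul (Sh k) x))) ->
  F =1 G.
Proof.
move=> FG; apply: vec_linear_ext => s.
have [n] := ubnP (size s); elim: n s => // n IH s; rewrite ltnS => sn ps.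
have ms := isperm_wmax ps.
(* The term i = [size s] is split off: there the first factor is [s] itself and the second is the
   unit. *)
have conv (H : {linear {malg k[basis isperm]} -> {malg k[basis packed]}}) :
    hmul_tens (QSh k) (tensmap H (@Phi k) (hcomul (Sh k) (vec k isperm s))) =
    \sum_(0 <= i < size s) hmul (QSh k) (H (vec k isperm (restr 1 i s)))
      (Phi (vec k isperm (pack (restr i.+1 (size s) s)))) + H (vec k isperm s).
  rewrite hcomul_vec // /delta ms (linear_sum (tensmap H (@Phi k))).
  rewrite (linear_sum (hmul_tens (QSh k))) big_nat_recr //=; congr (_ + _).
    by apply: eq_bigr => i _; rewrite tensmap_tens hmul_tensE.
  have -> : restr 1 (size s) s = s.
    by apply/all_filterP/allP => x; rewrite mem_isperm.
  have -> : restr (size s).+1 (size s) s = [::].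
    apply/eqP; rewrite -size_eq0.
    by have [_ ->] := size_restr_isperm ps (leqnn _); rewrite subnn.
  by rewrite tensmap_tens hmul_tensE /= Phi_one hmul_vec_nil.
have {}FG := etrans (esym (conv F)) (etrans (FG (vec k isperm s)) (conv G)).
have lower : \sum_(0 <= i < size s) hmul (QSh k) (F (vec k isperm (restr 1 i s)))
      (Phi (vec k isperm (pack (restr i.+1 (size s) s)))) =
    \sum_(0 <= i < size s) hmul (QSh k) (G (vec k isperm (restr 1 i s)))
      (Phi (vec k isperm (pack (restr i.+1 (size s) s)))).
  apply: eq_big_nat => i /andP[_ is_]; congr (hmul _ _ _); apply: IH.
    by have [-> _] := size_restr_isperm ps (ltnW is_); apply: leq_trans is_ sn.
  by rewrite isperm_restr // ms ltnW.
exact: addrI (etrans (congr1 (+%R^~ (F (vec k isperm s))) (esym lower)) FG).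
Qed.

End HopfMorphism.

Theorem theorem29 (k : fieldType) (hchar : [pchar k] =i pred0) :
  [/\ hopf_morphism (Sh k) (QSh k) (@Phi k),
      injective (@Phi k)
    & forall (n : nat) (s t : word),
        s \in words isperm n -> t \in words isperm n ->
        Phi (vec k isperm (wcomp s t)) = rcomp t (Phi (vec k isperm s))].
Proof.
have PhiM x y : Phi (hmul (Sh k) x y) = hmul (QSh k) (Phi x) (Phi y).
  apply: hmul_morphism => b c.
  by rewrite -!vec_val; apply: Phi_star hchar _ _ (valP b) (valP c).
have Phi_comul x : hcomul (QSh k) (Phi x) = tensmap (@Phi k) (@Phi k) (hcomul (Sh k) x).
  move: x; apply: (vec_linear_ext (F := hcomul (QSh k) \o @Phi k)
    (G := tensmap (@Phi k) (@Phi k) \o hcomul (Sh k))) => s ps.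
  by rewrite /= hcomul_vec // Phi_delta.
split; last exact: Phi_equivariant; last exact: Phi_inj.
split => //; first exact: Phi_linear.
- exact: Phi_one.
- exact: Phi_counit.
(* It suffices to compare the convolutions with [Phi]; both equal the counit times the unit. *)
move=> S S' hS hS'; apply: (@convolution_cancel k (@Phi k \o S) (S' \o @Phi k)) => x.
have [hSx _] := hS x; have [hS'x _] := hS' (Phi x).
transitivity (hcounit (Sh k) x *: oneb (QSh k)).
  (* As [Phi] is multiplicative, convolving Phi o S with [Phi] gives [Phi] of the convolution of [S]
     with the identity. *)
  rewrite -[oneb _]/(vec k packed [::]) -Phi_one -linearZ /=.
  rewrite -[vec k isperm [::]]/(oneb (Sh k)) -hSx.
  have e := tensmap_comp S idfun (@Phi k) (@Phi k) (hcomul (Sh k) x).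
  exact: esym (etrans (hmul_tens_morphism PhiM _) (congr1 (hmul_tens (QSh k)) e)).
(* As [Phi] respects coproducts, convolving S' o Phi with [Phi] gives the convolution of [S'] with
   the identity, evaluated at [Phi x]. *)
rewrite -Phi_counit -hS'x Phi_comul; congr (hmul_tens _ _).
exact: tensmap_comp (@Phi k) (@Phi k) S' idfun (hcomul (Sh k) x).
Qed.
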